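(* Let $u\in L^{\infty}(Q)^{d}$ with $\operatorname{div}(u)\in L^{\infty}(Q)$, let $c_b\in G_-$, and let $f:\mathbb{R}\to\mathbb{R}$ be $k$-Lipschitz with $k<\frac{1}{c_p}$. Then there is a unique $c\in H(u,Q)$ such that $$\int_{Q}\widetilde{\operatorname{div}}(\widetilde{u}c)\,\widetilde{\operatorname{div}}(\widetilde{u}\phi)\,dx\,dt=\int_{Q}f(c)\,\widetilde{\operatorname{div}}(\widetilde{u}\phi)\,dx\,dt\qquad\text{for all }\phi\in H_0(u,Q,\partial Q_-)$$ and $\gamma_{\widetilde n_-}(c)=c_b$.
   Context: Let $\Omega\subset\mathbb{R}^d$ ($d\geq 1$) be a domain with Lipschitz boundary satisfying the cone property, $T>0$, $Q=\Omega\times]0,T[$. For $u=(u_1,\dots,u_d)\in L^\infty(Q)^d$ with (spatial divergence) $\operatorname{div}(u)\in L^\infty(Q)$, set $\widetilde u=(1,u_1,\dots,u_d)$ and let $\widetilde n$ be the outer unit normal to $\partial Q$. The normal trace $(\widetilde u,\widetilde n)$ belongs to $L^\infty(\partial Q)$. Let $\Gamma_-=\{x\in\partial\Omega:(n(x),u(x,t))<0\ \forall t\in(0,T)\}$, where $n$ is the outer normal to $\partial\Omega$ and $\Gamma_-$ is assumed independent of $t$; let $\partial Q_-=\{(x,t)\in\partial Q:(\widetilde u,\widetilde n)<0\}=\Omega\times\{0\}\cup\Gamma_-\times]0,T[$. Write $\widetilde{\operatorname{div}}(\widetilde u\phi)=\frac{\partial\phi}{\partial t}+\sum_{i=1}^d\frac{\partial(u_i\phi)}{\partial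 x_i}$. Let $D(\overline Q)$ be the space of smooth functions on $\overline Q$ (restrictions of compactly supported smooth functions), with norm $\|\phi\|^2=\|\phi\|_{L^2(Q)}^2+\|\widetilde{\operatorname{div}}(\widetilde u\phi)\|_{L^2(Q)}^2-\int_{\partial Q_-}\phi^2(\widetilde u,\widetilde n)\,ds$, and let $H(u,Q)$ be the completion (closure) of $D(\overline Q)$ for this norm. $\gamma_{\widetilde n_-}:H(u,Q)\to L^2(\partial Q_-;|(\widetilde u,\widetilde n)|)$ is the continuous linear trace operator extending $\phi\mapsto\phi|_{\partial Q_-}$; $G_-=\gamma_{\widetilde n_-}(H(u,Q))$ and $H_0(u,Q,\partial Q_-)=H(u,Q)\cap\operatorname{Ker}\gamma_{\widetilde n_-}$. The constant $c_p>0$ is a constant of the curved Poincaré inequality (known to hold): for all $\phi\in H(u,Q)$, $$\|\phi\|_{L^2(Q)}^2\le c_p^2\Big(\|\widetilde{\operatorname{div}}(\widetilde u\phi)\|_{L^2(Q)}^2-\int_{\partial Q_-}\phi^2(\widetilde u,\widetilde n)\,ds\Big).$$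
   Formalization: The formal theorem additionally assumes that Ω has finite measure or f(0)=0, so that f(c) lies in L²(Q); otherwise the claim fails, e.g. Ω=ℝ, u=0, f=1, c_b=0 would force ∂c/∂t=1, which is not in L²(Q). *)

(* Defs.v *)
From HB Require Import structures.
From mathcomp Require Import all_boot all_order all_algebra.
From mathcomp Require Import all_classical all_reals all_analysis.
From mathcomp Require Import ring lra.

Set Implicit Arguments.
Unset Strict Implicit.
Unset Printing Implicit Defensive.
Import Order.TTheory GRing.Theory Num.Theory.
Import numFieldNormedType.Exports.
Import measurable_realfun.

Local Open Scope classical_set_scope.
Local Open Scope ring_scope.

Section borel_rV.
Variables (R : realType) (n : nat).

Let opens : set (set 'rV[R]_n) := [set A | open A].

HB.instance Definition _ := @isMeasurable.Build (sigma_display opens) 'rV[R]_n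
  <<s opens >> (@sigma_algebra0 _ setT opens) (@sigma_algebraC _ opens)
  (@sigma_algebra_bigcup _ setT opens).

Lemma open_measurable_rV (A : set 'rV[R]_n) : open A -> measurable A.
Proof. exact: sub_sigma_algebra. Qed.

Lemma measurable_coord (i : 'I_n) :
  measurable_fun [set: 'rV[R]_n] (fun x : 'rV[R]_n => x ord0 i).
Proof.
apply: (measurability _ (RGenOpens.measurableE R)).
move=> _ [_ [a [b ->] <-]]; rewrite setTI; apply: open_measurable_rV.
apply: open_comp; last exact: interval_open.
by move=> x _; exact: coord_continuous.
Qed.

Let rbox (qk : 'rV[rat]_n * nat) : set 'rV[R]_n :=
  [set x | forall i, `|x ord0 i - ratr (qk.1 ord0 i)| < qk.2.+1%:R^-1].

Lemma open_rV_bigcup (U : set 'rV[R]_n) : open U ->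
  U = \bigcup_(qk in [set qk | rbox qk `<=` U]) rbox qk.
Proof.
move=> oU; apply/seteqP; split=> [x Ux|x [qk /= qkU] qkx]; last exact: qkU.
have /nbhs_ballP [e /= e0 xeU] : nbhs x U by exact: open_nbhs_nbhs.
have e20 : 0 < e / 2 by rewrite divr_gt0.
have [k _ /(_ k (leqnn k))/= kE] := near_infty_natSinv_lt (PosNum e20).
have P i : exists q : rat, `|x ord0 i - ratr q| < k.+1%:R^-1.
  have [y [xy [q _ qy]]] : ball (x ord0 i) k.+1%:R^-1 `&` range (@ratr R) !=set0.
    apply: dense_rat; last exact: ball_open.
    by exists (x ord0 i); apply: ballxx; rewrite invr_gt0.
  by exists q; rewrite qy.
have [q qP] := @choice _ _ (fun i q => `|x ord0 i - ratr q| < k.+1%:R^-1) P.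
exists (\row_i q i, k) => /=; last by move=> i; rewrite mxE.
move=> y /= yq; apply: xeU; split => // i j; rewrite ord1.
have := yq j; have := qP j; rewrite mxE => h1 h2.
rewrite /ball /= -(subrKA (ratr (q j))).
rewrite (le_lt_trans (ler_normD _ _))// (splitr e) ltrD//.
  exact: (lt_trans h1).
by rewrite distrC; exact: (lt_trans h2).
Qed.

Lemma measurable_fun_rV d (T : measurableType d) (f : T -> 'rV[R]_n) :
  (forall i, measurable_fun [set: T] (fun t => f t ord0 i)) ->
  measurable_fun [set: T] f.
Proof.
move=> mf; apply: (@measurability _ _ _ _ setT f opens); first by [].
move=> _ [U oU <-]; rewrite setTI (open_rV_bigcup oU) preimage_bigcup.
rewrite bigcup_mkcond; apply: countable_bigcupT_measurable => // -[q k].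
case: ifPn => // _.
rewrite [X in measurable X](_ : _ = \bigcap_(i in [set: 'I_n])
   ((fun t => f t ord0 i) @^-1`
     [set` `]ratr (q ord0 i) - k.+1%:R^-1, ratr (q ord0 i) + k.+1%:R^-1[])).
  apply: fin_bigcap_measurable; first exact: finite_finset.
  by move=> i _; rewrite -[X in measurable X]setTI; exact: mf.
apply/seteqP; split=> t /= h i; first by rewrite /= in_itv/= -ltr_distl h.
by have := h i I; rewrite /= in_itv/= -ltr_distl.
Qed.

End borel_rV.

Section lebesgue_rV.
Variable R : realType.

Definition rV_cons n (p : R * 'rV[R]_n) : 'rV[R]_n.+1 :=
  \row_j oapp (p.2 ord0) p.1 (unlift ord0 j).
Definition rV_uncons n (x : 'rV[R]_n.+1) : R * 'rV[R]_n :=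
  (x ord0 ord0, \row_i x ord0 (lift ord0 i)).

Lemma rV_consK n : cancel (@rV_cons n) (@rV_uncons n).
Proof.
move=> [t x]; rewrite /rV_cons /rV_uncons /= mxE unlift_none /=; congr (_, _).
by apply/rowP => j; rewrite !mxE liftK.
Qed.

Lemma measurable_rV_cons n : measurable_fun setT (@rV_cons n).
Proof.
apply: measurable_fun_rV => j; case: (unliftP ord0 j) => [k ->|->].
  rewrite (_ : (fun t => _) = (fun x : 'rV[R]_n => x ord0 k) \o snd).
    by apply: measurableT_comp; [exact: measurable_coord|exact: measurable_snd].
  by apply/funext => t; rewrite /rV_cons mxE liftK.
rewrite (_ : (fun t => _) = fst); first exact: measurable_fst.
by apply/funext => t; rewrite /rV_cons mxE unlift_none.
Qed.

Lemma measurable_rV_uncons n : measurable_fun setT (@rV_uncons n).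
Proof.
apply: measurable_fun_pair; first exact: measurable_coord.
apply: measurable_fun_rV => j.
rewrite (_ : (fun t => _) = (fun x : 'rV[R]_n.+1 => x ord0 (lift ord0 j))).
  exact: measurable_coord.
by apply/funext => x; rewrite mxE.
Qed.

Section step.
Variables (n : nat) (mu : {sigma_finite_measure set 'rV[R]_n -> \bar R}).

Definition lebesgue_next : set 'rV[R]_n.+1 -> \bar R :=
  pushforward ((@lebesgue_measure R) \x mu)%E (@rV_cons n).

Let mcons := @measurable_rV_cons n.

Let lebesgue_next0 : lebesgue_next set0 = 0%E.
Proof. exact: measure0. Qed.

Let lebesgue_next_ge0 A : (0 <= lebesgue_next A)%E.
Proof. exact: measure_ge0. Qed.

Let lebesgue_next_sigma_additive : semi_sigma_additive lebesgue_next.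
Proof. exact: measure_semi_sigma_additive. Qed.

HB.instance Definition _ := isMeasure.Build _ _ _ lebesgue_next
  lebesgue_next0 lebesgue_next_ge0 lebesgue_next_sigma_additive.

Let lebesgue_next_sigma_finite : sigma_finite setT lebesgue_next.
Proof.
have /sigma_finiteP[F [FT ndF Foo]] := sigma_finiteT (@lebesgue_measure R).
have /sigma_finiteP[G [GT ndG Goo]] := sigma_finiteT mu.
exists (fun k => @rV_uncons n @^-1` (F k `*` G k)).
  rewrite -preimage_bigcup; apply/seteqP; split => // x _.
  have [i _ Fi] : (\bigcup_k F k) (rV_uncons x).1 by rewrite -FT.
  have [j _ Gj] : (\bigcup_k G k) (rV_uncons x).2 by rewrite -GT.
  exists (maxn i j) => //; split.
  - by move: Fi; exact/subsetPset/ndF/leq_maxl.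
  - by move: Gj; exact/subsetPset/ndG/leq_maxr.
move=> k; have [mF Fk] := Foo k; have [mG Gk] := Goo k; split.
  rewrite -[X in measurable X]setTI; apply: measurable_rV_uncons => //.
  exact: measurableX.
rewrite /lebesgue_next /pushforward -comp_preimage.
rewrite (_ : _ \o _ = id); last exact/funext/rV_consK.
by rewrite preimage_id product_measure1E// lte_mul_pinfty// ge0_fin_numE.
Qed.

HB.instance Definition _ :=
  Measure_isSigmaFinite.Build _ _ _ lebesgue_next
  lebesgue_next_sigma_finite.

End step.

Fixpoint lebesgue_rV n : {sigma_finite_measure set 'rV[R]_n -> \bar R} :=
  if n is m.+1 then lebesgue_next (lebesgue_rV m) else dirac (0 : 'rV[R]_0).

Lemma lebesgue_rV_rect n (A : 'I_n -> set R) :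
  (forall i, measurable (A i)) ->
  (lebesgue_rV n [set x | forall i, A i (x ord0 i)] =
   \prod_(i < n) lebesgue_measure (A i))%E.
Proof.
elim: n A => [|n ih] A mA.
  rewrite big_ord0 /= diracE mem_set//; by case.
rewrite big_ord_recl -ih//= /lebesgue_next /pushforward.
have mB : measurable [set x : 'rV[R]_n | forall i, A (lift ord0 i) (x ord0 i)].
  rewrite [X in measurable X](_ : _ = \bigcap_(i in [set: 'I_n])
     ((fun x : 'rV[R]_n => x ord0 i) @^-1` A (lift ord0 i))).
    apply: fin_bigcap_measurable => // i _; rewrite -[X in measurable X]setTI.
    exact: measurable_coord.
  by apply/seteqP; split => x /= h i; [move=> _|]; exact: h.
apply: etrans
  (product_measure1E lebesgue_measure (lebesgue_rV n) (mA ord0) mB).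
congr (product_measure1 _ _ _); apply/seteqP; split => -[t x] /=.
  move=> h; split; first by have := h ord0; rewrite mxE unlift_none.
  by move=> i; have := h (lift ord0 i); rewrite mxE liftK.
move=> [h0 h] i; case: (unliftP ord0 i) => [j ->|->]; rewrite mxE ?liftK ?unlift_none //=.
Qed.

End lebesgue_rV.

(* Caratheodory's criterion. *)
Section metric_outer_measure.
Variables (R : realType) (V : normedModType R).
Variable H : {outer_measure set V -> \bar R}.
Local Open Scope ereal_scope.

Hypothesis H_separated : forall (A B : set V) (r : R), (0 < r)%R ->
  (forall x y, A x -> B y -> (r <= `|x - y|)%R) -> H A + H B <= H (A `|` B).

Lemma metric_outer_measure_closed (F : set V) :
  closed F -> H.-caratheodory F.
Proof.
move=> cF; apply: le_caratheodory_measurable => X.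
have [->|HX] := eqVneq (H X) +oo; first by rewrite leey.
have {}HX : H X < +oo by rewrite ltey.
have fin (A : set V) : A `<=` X -> H A \is a fin_num.
  move=> AX; rewrite ge0_fin_numE ?outer_measure_ge0//.
  exact: le_lt_trans (le_outer_measure H _ _ AX) HX.
pose A k : set V := [set x | X x /\ forall y, F y -> (k.+1%:R^-1 <= `|x - y|)%R].
pose D k : set V := A k.+1 `\` A k.
have AX k : A k `<=` X by move=> x [].
have DX k : D k `<=` X by move=> x [[]].
have A_le i j : (i <= j)%N -> A i `<=` A j.
  move=> ij x [Xx xF]; split => // y /xF; apply: le_trans.
  by rewrite lef_pV2 ?posrE// ler_nat ltnS.
pose a k : R := fine (H (A k)).
have aE k : H (A k) = (a k)%:E by rewrite /a fineK// fin.
have sep k : H (D k.+1) + H (A k) <= H (A k.+2).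
  have : H (D k.+1) + H (A k) <= H (D k.+1 `|` A k).
    apply: (H_separated (r := k.+1%:R^-1 - k.+2%:R^-1)).
      by rewrite subr_gt0 ltf_pV2 ?posrE// ltr_nat.
    move=> x y [[Xx _] xA] [Xy yF].
    have [z Fz xz] : exists2 z, F z & (`|x - z| < k.+2%:R^-1)%R.
      apply/not_exists2P => h; apply: xA; split => // z Fz.
      by rewrite leNgt; apply/negP => ?; have [] := h z.
    rewrite lerBlDr (le_trans (yF z Fz))//.
    rewrite -(subrKA x) (le_trans (ler_normD _ _))//.
    by rewrite (distrC y x) lerD2l ltW.
  move/le_trans; apply; apply: le_outer_measure => x [[]//|].
  by apply: A_le; exact: leqW.
have XFA k : H (X `&` F) + H (A k) <= H X.
  have : H (X `&` F) + H (A k) <= H ((X `&` F) `|` A k).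
    apply: (H_separated (r := k.+1%:R^-1)) => //.
    by move=> x y [_ Fx] [_ yF]; rewrite distrC; exact: yF.
  by move/le_trans; apply; apply: le_outer_measure => x [[]//|[]].
have cover k : X `&` ~` F `<=` A k.+1 `|` \bigcup_(i in ~` `I_k.+1) D i.
  move=> x [Xx nFx].
  have /nbhs_ballP[e /= e0 xeF] : nbhs x (~` F).
    by apply: open_nbhs_nbhs; split => //; exact: closed_openC.
  have [m _ /(_ m (leqnn m))/= mE] := near_infty_natSinv_lt (PosNum e0).
  have Am : A m x.
    split => // y Fy; rewrite leNgt; apply/negP => xy.
    apply: (xeF y) Fy; rewrite -ball_normE /=; exact: lt_trans mE.
  have [Ak|nAk] := pselect (A k.+1 x); [by left|right].
  have ex : exists m, `[< A m x >] by exists m; apply/asboolP.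
  case: (ex_minnP ex) => -[|j] /asboolP Aj jmin.
    by exfalso; apply: nAk; by apply: A_le Aj.
  have kj : (k < j)%N.
    rewrite ltnNge; apply/negP => jk; apply: nAk; by apply: A_le Aj.
  exists j; first by apply/negP; rewrite -leqNgt.
  split => // Ajx; have := jmin j; rewrite ltnn => h.
  by have : false by apply: h; apply/asboolP.
have tail k N : (\sum_(k <= i < N) fine (H (D i.+1)) <= 
     (if (k < N)%N then a N.+1 + a N - a k.+1 - a k else 0))%R.
  elim: N => [|N ih]; first by rewrite big_geq /=.
  have [kN|kN] := leqP k N; last by rewrite big_geq // ltnS leqNgt kN.
  rewrite big_nat_recr//= ltnS kN.
  have dN : (fine (H (D N.+1)) <= a N.+2 - a N)%R.
    rewrite lerBrDr -lee_fin EFinD fineK ?fin//.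
    by rewrite -!aE sep.
  have [kN'|kN'] := ltnP k N.
    rewrite kN' in ih; apply: (le_trans (lerD ih dN)).
    by rewrite le_eqVlt; apply/orP; left; apply/eqP; ring.
  have kE : k = N by apply/eqP; rewrite eqn_leq kN.
  rewrite kE big_geq// add0r (le_trans dN)// le_eqVlt; apply/orP; left.
  by apply/eqP; ring.
pose h := fine (H (X `&` ~` F)).
have hE : H (X `&` ~` F) = h%:E by rewrite /h fineK// fin.
pose L := fine (ereal_sup (range (fun k => (a k)%:E))).
have supE : ereal_sup (range (fun k => (a k)%:E)) = L%:E.
  rewrite /L fineK// ge0_fin_numE.
    apply: (@le_lt_trans _ _ (H X)) => //; apply: ge_ereal_sup => _ [k _ <-].
    by rewrite -aE le_outer_measure.
  by apply: (@le_trans _ _ (a 0%N)%:E); [rewrite -aE outer_measure_ge0|apply: ereal_sup_ubound; exists 0%N].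
have aL k : (a k <= L)%R.
  by rewrite -lee_fin -supE; apply: ereal_sup_ubound; exists k.
have LE (M : R) : (forall k, a k <= M)%R -> (L <= M)%R.
  by move=> aM; rewrite -lee_fin -supE; apply: ge_ereal_sup => _ [k _ <-]; rewrite lee_fin.
have hL k : (h <= 2 * L - a k)%R.
  rewrite -lee_fin -hE.
  apply: (le_trans (le_outer_measure H _ _ (cover k))).
  apply: (le_trans (outer_measureU2 _ _ _)).
  rewrite aE; apply: (@le_trans _ _ ((a k.+1)%:E + (2 * L - a k.+1 - a k)%:E)); last first.
    by rewrite -EFinD lee_fin le_eqVlt; apply/orP; left; apply/eqP; ring.
  apply: leeD2l.
  apply: (le_trans (outer_measure_sigma_subadditive_tail _ _ _)).
  apply: lime_le; first by apply: is_cvg_nneseries => *; exact: outer_measure_ge0.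
  apply: nearW => N; rewrite big_add1.
  rewrite (eq_bigr (fun i => (fine (H (D i.+1)))%:E)); last first.
    by move=> i _; rewrite fineK// fin.
  rewrite sumEFin lee_fin (le_trans (tail _ _))//.
  have := aL N.-1.+1; have := aL N.-1; have := aL k; have := aL k.+1.
  by case: ifP => _; lra.
rewrite hE.
have hL' : (h <= L)%R.
  suff : (L <= 2 * L - h)%R by rewrite lerBrDr -lerBrDl => /le_trans; apply; rewrite le_eqVlt; apply/orP; left; apply/eqP; ring.
  by apply: LE => k; rewrite lerBrDr -lerBrDl; exact: hL.
apply: (@le_trans _ _ (H (X `&` F) + L%:E)); first by rewrite leeD2l// lee_fin.
have f1 := fin (X `&` F) (@subIsetl _ _ _).
rewrite -leeBrDl// -supE; apply: ge_ereal_sup => _ [k _ <-].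
by rewrite leeBrDl// -aE.
Qed.
End metric_outer_measure.

Section euclidean.
Variable R : realType.

(* The library's norm on 'rV[R]_n is the sup norm, whence a separate enorm. *)
Definition dotv n (x y : 'rV[R]_n) : R := \sum_i x ord0 i * y ord0 i.

Definition enorm n (x : 'rV[R]_n) : R := Num.sqrt (dotv x x).

Lemma mx_norm_le_enorm n (x : 'rV[R]_n) : `|x| <= enorm x.
Proof.
change (mx_norm x <= enorm x).
have [->|x0] := eqVneq (mx_norm x) 0; first by rewrite sqrtr_ge0.
have [[i j] ->] := mx_norm_neq0 x0 => /=; rewrite (ord1 i).
rewrite -sqrtr_sqr ler_wsqrtr// /dotv (bigD1 j)//= -expr2 lerDl.
by apply: sumr_ge0 => k _; rewrite -expr2 sqr_ge0.
Qed.

End euclidean.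

Section hausdorff.
Variables (R : realType) (n s : nat).
Local Open Scope ereal_scope.
Implicit Types A B : set 'rV[R]_n.

Definition ediam A : \bar R :=
  ereal_sup [set (enorm (p.1 - p.2))%:E | p in A `*` A].

(* volume of the Euclidean unit ball of R^s *)
Definition ball_volume : R :=
  fine (lebesgue_rV R s [set x : 'rV[R]_s | (enorm x <= 1)%R]).

Definition hausdorff_gauge (delta : R) A : \bar R :=
  if A == set0 then 0
  else if ediam A <= delta%:E then (ball_volume * (fine (ediam A) / 2) ^+ s)%:E
  else +oo.

(* Covering by Borel sets instead of arbitrary sets changes nothing, since a
   set and its closure have the same diameter. *)
Definition hausdorff A : \bar R :=
  ereal_sup [set mu_ext (hausdorff_gauge delta) A | delta in [set e | (0 < e)%R]].

Let gauge0 delta : hausdorff_gauge delta set0 = 0.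
Proof. by rewrite /hausdorff_gauge eqxx. Qed.

Let gauge_ge0 delta A : 0 <= hausdorff_gauge delta A.
Proof.
rewrite /hausdorff_gauge; case: ifPn => // /set0P[x Ax]; case: ifP => // Ad.
rewrite lee_fin mulr_ge0//; first by rewrite fine_ge0.
rewrite exprn_ge0// divr_ge0// fine_ge0//.
apply: (@le_trans _ _ (enorm (x - x))%:E); first by rewrite lee_fin sqrtr_ge0.
by apply: ereal_sup_ubound; exists (x, x).
Qed.

Let hausdorff_ubound delta A : (0 < delta)%R ->
  mu_ext (hausdorff_gauge delta) A <= hausdorff A.
Proof. by move=> d0; apply: ereal_sup_ubound; exists delta. Qed.

Lemma hausdorff_ge0 A : 0 <= hausdorff A.
Proof.
by apply: le_trans (hausdorff_ubound A (@ltr01 R)); exact: mu_ext_ge0.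
Qed.

Lemma hausdorff0 : hausdorff set0 = 0.
Proof.
apply/eqP; rewrite eq_le hausdorff_ge0 andbT; apply: ge_ereal_sup => _ [d _ <-].
by rewrite mu_ext0.
Qed.

Lemma le_hausdorff : {homo hausdorff : A B / A `<=` B >-> A <= B}.
Proof.
move=> A B AB; apply: ge_ereal_sup => _ [d d0 <-].
by apply: le_trans (hausdorff_ubound B d0); exact: le_mu_ext.
Qed.

Lemma hausdorff_sigma_subadditive : sigma_subadditive hausdorff.
Proof.
move=> F; apply: ge_ereal_sup => _ [d d0 <-].
apply: le_trans (mu_ext_sigma_subadditive (gauge_ge0 d) F) _.
by apply: lee_nneseries => *; [exact: mu_ext_ge0|exact: hausdorff_ubound].
Qed.

HB.instance Definition _ := isOuterMeasure.Build R 'rV[R]_n hausdorff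
  hausdorff0 hausdorff_ge0 le_hausdorff hausdorff_sigma_subadditive.

Let le_gauge (d1 d2 : R) A : (d1 <= d2)%R ->
  hausdorff_gauge d2 A <= hausdorff_gauge d1 A.
Proof.
move=> d12; rewrite /hausdorff_gauge; case: ifPn => // _.
case: ifPn => h1; case: ifPn => h2 //; first by rewrite leey.
by exfalso; move/negP: h1; apply; rewrite (le_trans h2)// lee_fin.
Qed.

Let le_mu_gauge (d1 d2 : R) A : (d1 <= d2)%R ->
  mu_ext (hausdorff_gauge d2) A <= mu_ext (hausdorff_gauge d1) A.
Proof.
move=> d12; apply: le_ereal_inf_tmp => _ [F FA <-].
apply: (@le_trans _ _ (\sum_(k <oo) hausdorff_gauge d2 (F k))).
  by apply: ereal_inf_lbound; exists F.
by apply: lee_nneseries => *; [exact: gauge_ge0|exact: le_gauge].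
Qed.

Lemma hausdorff_separated A B (r : R) : (0 < r)%R ->
  (forall x y, A x -> B y -> (r <= `|x - y|)%R) ->
  hausdorff A + hausdorff B <= hausdorff (A `|` B).
Proof.
move=> r0 ABr.
have main (d : R) : (0 < d)%R -> (d < r)%R ->
    mu_ext (hausdorff_gauge d) A + mu_ext (hausdorff_gauge d) B <=
    hausdorff (A `|` B).
  move=> d0 dr; apply: le_trans (hausdorff_ubound _ d0).
  apply: le_ereal_inf_tmp => _ [F [mF ABF] <-].
  pose G (C : set 'rV[R]_n) k := if F k `&` C == set0 then set0 else F k.
  have GC C : C `<=` A `|` B -> measurable_cover C (G C).
    move=> CAB; split => [k|x Cx]; first by rewrite /G; case: ifP.
    have [k _ Fk] := ABF _ (CAB _ Cx); exists k => //; rewrite /G ifF//.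
    by apply/negP => /eqP FC; have : (F k `&` C) x by []; rewrite FC.
  apply: (@le_trans _ _ (\sum_(k <oo) hausdorff_gauge d (G A k) +
                         \sum_(k <oo) hausdorff_gauge d (G B k))).
    by apply: leeD; apply: ereal_inf_lbound; [exists (G A)|exists (G B)];
      rewrite //; apply: GC => x; [left|right].
  rewrite -nneseriesD; try by move=> *; exact: gauge_ge0.
  apply: lee_nneseries => k _; first by rewrite adde_ge0// gauge_ge0.
  rewrite /G; case: ifPn => [_|/set0P[x [Fx Ax]]].
    by rewrite gauge0 add0e; case: ifP => _; rewrite ?gauge0.
  case: ifPn => [_|/set0P[y [Fy By]]]; first by rewrite gauge0 adde0.
  rewrite [leRHS]/hausdorff_gauge ifF; last by apply/negP => /eqP Fk; rewrite Fk in Fx.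
  case: ifPn => [Fd|]; last by rewrite leey.
  exfalso; have := ABr _ _ Ax By; apply/negP; rewrite -ltNge.
  apply: le_lt_trans dr; apply: le_trans (mx_norm_le_enorm _) _.
  rewrite -lee_fin; apply: le_trans Fd; apply: ereal_sup_ubound.
  by exists (x, y).
have [->|Hoo] := eqVneq (hausdorff (A `|` B)) +oo; first by rewrite leey.
have fAB : hausdorff (A `|` B) \is a fin_num.
  by rewrite ge0_fin_numE ?hausdorff_ge0// ltey.
have fA : hausdorff A \is a fin_num.
  rewrite ge0_fin_numE ?hausdorff_ge0//; apply: (@le_lt_trans _ _ (hausdorff (A `|` B))).
    by apply: le_hausdorff => x; left.
  by rewrite ltey.
rewrite -leeBrDl//; apply: ge_ereal_sup => _ [d2 /= d20 <-].
have f2 : mu_ext (hausdorff_gauge d2) B \is a fin_num.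
  rewrite ge0_fin_numE ?mu_ext_ge0//; apply: (@le_lt_trans _ _ (hausdorff (A `|` B))).
    by apply: le_trans (hausdorff_ubound _ d20) _; apply: le_hausdorff => x; right.
  by rewrite ltey.
rewrite leeBrDl// -leeBrDr//; apply: ge_ereal_sup => _ [d1 /= d10 <-].
rewrite leeBrDr//.
pose d : R := Num.min (Num.min d1 d2) (r / 2)%R.
apply: (le_trans _ (main d _ _)); last 2 first.
- by rewrite !lt_min d10 d20 divr_gt0.
- by rewrite gt_min [X in _ || X](_ : _ = true) ?orbT// ltr_pdivrMr// ltr_pMr// ltr1n.
by apply: leeD; apply: le_mu_gauge; rewrite !ge_min lexx ?orbT.
Qed.

Let borel_caratheodory (A : set 'rV[R]_n) :
  measurable A -> (hausdorff : set 'rV[R]_n -> \bar R).-caratheodory A.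
Proof.
apply: smallest_sub.
  split.
  - exact: caratheodory_measurable_set0.
  - by move=> B cB; rewrite setTD; exact: caratheodory_measurable_setC.
  - by move=> F cF; exact: caratheodory_measurable_bigcup.
move=> B oB; rewrite -(setCK B); apply: caratheodory_measurable_setC.
apply: metric_outer_measure_closed; last exact: open_closedC.
by move=> ? ? r; exact: hausdorff_separated.
Qed.

Let hausdorff_semi_sigma_additive : semi_sigma_additive hausdorff.
Proof.
move=> F mF tF mUF.
apply: (@caratheodory_measure_sigma_additive R 'rV[R]_n hausdorff F) => //.
- by move=> k; exact: borel_caratheodory.
- exact: borel_caratheodory.
Qed.

HB.instance Definition _ := isMeasure.Build _ _ _ hausdorff
  hausdorff0 hausdorff_ge0 hausdorff_semi_sigma_additive.

End hausdorff.

Section calculus.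
Variables (R : realType) (n : nat).
Implicit Types (A D : set 'rV[R]_n) (f g psi : 'rV[R]_n -> R).

Definition boundary A : set 'rV[R]_n := closure A `\` interior A.

Definition smooth f := forall s : seq 'rV[R]_n,
  let g : 'rV[R]_n -> R^o := foldr (fun v h => 'D_v h) (f : 'rV[R]_n -> R^o) s in
  continuous g /\ forall x v, derivable g x v.

Definition test_fun D psi :=
  [/\ smooth psi, compact (closure [set x | psi x != 0])
    & closure [set x | psi x != 0] `<=` D].

Definition partial (i : 'I_n) f : 'rV[R]_n -> R :=
  'D_(delta_mx ord0 i) (f : 'rV[R]_n -> R^o).

Definition sqnorm D f : \bar R :=
  (\int[lebesgue_rV R n]_(x in D) ((f x) ^+ 2)%:E)%E.

(* The functions below live on D: they are total, but only their values on D
   matter, which is why the whole-space predicate Lfun is not used. *)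
Definition L2 D f := measurable_fun D f /\ (sqnorm D f < +oo)%E.

Definition Linfty (mu : {measure set 'rV[R]_n -> \bar R}) D f :=
  measurable_fun D f /\
  exists M : R, {ae mu, forall x, D x -> `|f x| <= M}.

(* g is the divergence of the vector field F on D, in the sense of
   distributions. *)
Definition weak_div D (F : 'rV[R]_n -> 'rV[R]_n) g :=
  forall psi, test_fun D psi ->
    \int[lebesgue_rV R n]_(x in D) (\sum_i F x ord0 i * partial i psi x) =
    - \int[lebesgue_rV R n]_(x in D) (g x * psi x).

End calculus.

Section domains.
Variables (R : realType) (n : nat).

(* Near each boundary point, Om is the part lying above the graph of a
   Lipschitz function over the hyperplane orthogonal to a unit vector e;
   x - (x.e)e is the orthogonal projection of x on that hyperplane. *)
Definition lipschitz_boundary (Om : set 'rV[R]_n) :=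
  forall x0, boundary Om x0 ->
  exists (e : 'rV[R]_n) (gamma : 'rV[R]_n -> R) (r L : R),
    [/\ enorm e = 1, 0 < r,
        forall x y, `|gamma x - gamma y| <= L * enorm (x - y) &
        forall x, enorm (x - x0) < r ->
          (Om x <-> gamma (x - dotv x e *: e) < dotv x e)].

(* Every point of Om is the vertex of a cone contained in Om and congruent to
   a fixed finite cone (height rho, half-angle arccos kappa). *)
Definition cone_property (Om : set 'rV[R]_n) :=
  exists rho kappa : R, [/\ 0 < rho, 0 < kappa < 1 &
    forall x, Om x -> exists2 e : 'rV[R]_n, enorm e = 1 &
      forall y, enorm y <= rho -> kappa * enorm y <= dotv y e -> Om (x + y)].

End domains.

(* Points (x, t) of space-time are represented as row vectors (t, x_1, ..., x_d)
   so that (1, u_1, ..., u_d) is a vector field on space-time. *)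
Section spacetime.
Variables (R : realType) (d : nat).
Implicit Types (Om : set 'rV[R]_d) (Q : set 'rV[R]_d.+1) (T : R)
  (u : 'rV[R]_d.+1 -> 'rV[R]_d) (c w g nt phi : 'rV[R]_d.+1 -> R).

Definition time (z : 'rV[R]_d.+1) : R := (rV_uncons z).1.
Definition space (z : 'rV[R]_d.+1) : 'rV[R]_d := (rV_uncons z).2.
Definition at_time (x : 'rV[R]_d) (t : R) : 'rV[R]_d.+1 := rV_cons (t, x).

Definition cylinder Om T : set 'rV[R]_d.+1 :=
  [set z | Om (space z) /\ 0 < time z < T].

Definition tilde u (z : 'rV[R]_d.+1) : 'rV[R]_d.+1 := rV_cons (1, u z).

Definition is_spatial_div Q u g := weak_div Q (fun z => rV_cons (0, u z)) g.

(* w is the space-time divergence of phi * (1, u). *)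
Definition is_tdiv Q u phi w := weak_div Q (fun z => phi z *: tilde u z) w.

(* ds on the boundary of a domain of space-time, of dimension d *)
Definition surface : {measure set 'rV[R]_d.+1 -> \bar R} := hausdorff d.

(* nt is the normal trace of the field (1, u), whose divergence is divu: it is
   defined by Green's formula. For smooth data on Q = Om x ]0, T[ it is -1 on
   Om x {0}, 1 on Om x {T} and u.n on the lateral boundary. *)
Definition is_normal_trace Q u (divu nt : 'rV[R]_d.+1 -> R) :=
  Linfty surface (boundary Q) nt /\
  forall phi, test_fun setT phi ->
    \int[lebesgue_rV R d.+1]_(z in Q)
      (\sum_i tilde u z ord0 i * partial i phi z + divu z * phi z) =
    \int[surface]_(z in boundary Q) (phi z * nt z).

Definition inflow Q nt : set 'rV[R]_d.+1 := [set z | boundary Q z /\ nt z < 0].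

Definition Gamma_minus Om T nt : set 'rV[R]_d :=
  [set x | boundary Om x /\ forall t, 0 < t < T -> nt (at_time x t) < 0].

(* Gamma_minus does not depend on time. As nt is an element of L^infty, the
   equality holds up to a set of zero surface measure. *)
Definition inflow_cylindrical Om T nt :=
  {ae surface, forall z, inflow (cylinder Om T) nt z <->
    (Om (space z) /\ time z = 0) \/
    (Gamma_minus Om T nt (space z) /\ 0 < time z < T)}.

Definition inflow_sqnorm Q nt g : \bar R :=
  (\int[surface]_(z in inflow Q nt) (- ((g z) ^+ 2 * nt z))%:E)%E.

Definition inflow_L2 Q nt g :=
  measurable_fun (inflow Q nt) g /\ (inflow_sqnorm Q nt g < +oo)%E.

(* The square of the norm of H(u, Q), for a function c with w = tdiv ((1, u) c)
   and with trace g on the inflow boundary. *)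
Definition Hsqnorm Q nt c w g : \bar R :=
  (sqnorm Q c + sqnorm Q w + inflow_sqnorm Q nt g)%E.

(* in_H Q u nt c w g means: c is in H(u, Q), w = tdiv ((1, u) c) and g is the
   trace of c on the inflow boundary. The completion H(u, Q) is realized as the
   closure of the restrictions of C_c^infty functions in the Hilbert space
   L^2(Q) x L^2(Q) x L^2(inflow; |nt| ds) that contains their graphs, so that
   the divergence and the trace are the two last components. *)
Definition in_H Q u nt c w g :=
  [/\ L2 Q c, L2 Q w, inflow_L2 Q nt g, is_tdiv Q u c w &
   exists (phi_ w_ : nat -> 'rV[R]_d.+1 -> R),
     [/\ forall m, test_fun setT (phi_ m),
         forall m, L2 Q (w_ m) /\ is_tdiv Q u (phi_ m) (w_ m) &
         Hsqnorm Q nt (phi_ m \- c) (w_ m \- w) (phi_ m \- g) @[m --> \oo]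
           --> 0%E]].

Definition in_H0 Q u nt c w := in_H Q u nt c w (cst 0).

Definition in_G Q u nt g := exists c w, in_H Q u nt c w g.

Definition curved_poincare Q u nt (cp : R) :=
  forall c w g, in_H Q u nt c w g ->
  (sqnorm Q c <= (cp ^+ 2)%:E * (sqnorm Q w + inflow_sqnorm Q nt g))%E.

Definition is_solution Q u nt (f : R -> R) cb c w :=
  in_H Q u nt c w cb /\
  forall phi wphi, in_H0 Q u nt phi wphi ->
    \int[lebesgue_rV R d.+1]_(z in Q) (w z * wphi z) =
    \int[lebesgue_rV R d.+1]_(z in Q) (f (c z) * wphi z).

End spacetime.

(* Main.v *)
Require Import Defs.
From HB Require Import structures.
From mathcomp Require Import all_boot all_order all_algebra.
From mathcomp Require Import all_classical all_reals all_analysis.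
From mathcomp Require Import ring lra.

Set Implicit Arguments.
Unset Strict Implicit.
Unset Printing Implicit Defensive.
Import Order.TTheory GRing.Theory Num.Theory.
Import numFieldNormedType.Exports.
Import measurable_realfun.

Local Open Scope classical_set_scope.
Local Open Scope ring_scope.

(** Let (c0, w0) be a function of H(u, Q) with trace cb and its divergence. The
    unknown is c0 + psi with psi in H_0, the functions of zero trace. By the
    curved Poincare inequality, |psi| <= cp |w| in L^2 for psi in H_0 with
    divergence w, so that the inner product of divergences makes H_0 a complete
    space (complete_H0): this rests on the completeness of L^2 (riesz_fischer)
    and on the closedness of the graph that defines H(u, Q) (in_H_closed). The
    equation reads
      (w, v) = (f(c0 + psi) - w0, v)  for all divergences v of elements of H_0.
    For a frozen right-hand side it is solved by the Riesz representation, and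
    the solution depends on psi through f only, with Lipschitz constant
    k cp < 1 (forcing_contraction). Its fixed point is the solution
    (contractive_variational_equation, solution_exists).

    Applied to the difference of two solutions c and c', with divergences w and
    w', which lies in H_0 and may therefore serve as a test function, the same estimate gives
    |w - w'|^2 <= k cp |w - w'|^2. Hence w = w', and c = c' by the Poincare
    inequality (solution_unique).

    Functions are handled as such and not as classes modulo almost everywhere
    equality, whence inner products that are only semidefinite. The functions
    f(c) are square integrable because Q has finite measure or f(0) = 0. *)

(** * Semi-inner products *)

Section semi_inner_products.
Variables (R : realType) (V : lmodType R).

(** A positive semidefinite form is only required to be bilinear on the subspace
    P: an integral of a product is bilinear on square integrable functions and
    carries no meaning elsewhere. Semidefiniteness avoids quotients by almost
    everywhere equality. *)
Record semi_inner (P : set V) (B : V -> V -> R) : Prop := SemiInner {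
  si0 : P 0;
  siZD : forall a x y, P x -> P y -> P (a *: x + y);
  siC : forall x y, P x -> P y -> B x y = B y x;
  siZDl : forall a x y z, P x -> P y -> P z ->
    B (a *: x + y) z = a * B x z + B y z;
  si_ge0 : forall x, P x -> 0 <= B x x }.

Definition snorm (B : V -> V -> R) (x : V) : R := Num.sqrt (B x x).

(** It suffices to ask for limits of sequences whose increments decay
    geometrically, since every Cauchy sequence has such a subsequence; the
    factor 1/4 on squares is a factor 1/2 on norms. *)
Definition complete_for (P : set V) (B : V -> V -> R) :=
  forall x_ : nat -> V, (forall n, P (x_ n)) ->
    (forall n, B (x_ n.+1 - x_ n) (x_ n.+1 - x_ n) <= 4^-1 ^+ n) ->
  exists2 x, P x & B (x_ n - x) (x_ n - x) @[n --> \oo] --> (0 : R).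

Variables (P : set V) (B : V -> V -> R).
Hypothesis PB : semi_inner P B.

Let PZ a x : P x -> P (a *: x).
Proof.
by move=> Px; rewrite -[X in P X]addr0; apply: (siZD PB) => //; exact: si0 PB.
Qed.

Let PD x y : P x -> P y -> P (x + y).
Proof. by move=> Px Py; rewrite -[X in P (X + _)]scale1r; exact: (siZD PB). Qed.

Let PN x : P x -> P (- x).
Proof. by move=> Px; rewrite -scaleN1r; exact: PZ. Qed.

Lemma siPB x y : P x -> P y -> P (x - y).
Proof. by move=> Px Py; apply: PD => //; exact: PN. Qed.

Lemma siDl x y z : P x -> P y -> P z -> B (x + y) z = B x z + B y z.
Proof.
by move=> Px Py Pz; rewrite -[X in B (X + _)]scale1r (siZDl PB)// mul1r.
Qed.

Lemma si0l z : P z -> B 0 z = 0.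
Proof.
move=> Pz; have P0 := si0 PB; have := siDl P0 P0 Pz; rewrite addr0.
by move=> h; apply: (@addrI _ (B 0 z)); rewrite -h addr0.
Qed.

Lemma siZl a x z : P x -> P z -> B (a *: x) z = a * B x z.
Proof.
move=> Px Pz; have P0 := si0 PB.
by rewrite -[X in B X]addr0 (siZDl PB)// si0l// addr0.
Qed.

Lemma siNl x z : P x -> P z -> B (- x) z = - B x z.
Proof. by move=> Px Pz; rewrite -scaleN1r siZl// mulN1r. Qed.

Lemma siBl x y z : P x -> P y -> P z -> B (x - y) z = B x z - B y z.
Proof. by move=> Px Py Pz; rewrite siDl ?siNl//; exact: PN. Qed.

Lemma siZr a x z : P x -> P z -> B z (a *: x) = a * B z x.
Proof. by move=> Px Pz; rewrite !(siC PB Pz) ?siZl//; exact: PZ. Qed.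

Lemma siDr x y z : P x -> P y -> P z -> B z (x + y) = B z x + B z y.
Proof.
by move=> Px Py Pz; rewrite !(siC PB Pz) ?siDl//; exact: PD.
Qed.

Lemma siBr x y z : P x -> P y -> P z -> B z (x - y) = B z x - B z y.
Proof.
by move=> Px Py Pz; rewrite !(siC PB Pz) ?siBl//; exact: siPB.
Qed.

Lemma siZD_sqr a x y : P x -> P y ->
  B (a *: x + y) (a *: x + y) = a ^+ 2 * B x x + 2 * a * B x y + B y y.
Proof.
move=> Px Py; have PZx := PZ a Px; have Pxy := PD PZx Py.
rewrite siDl// !siDr// !siZl// ?siZr// (siC PB Py Px) ?siZl//.
by ring.
Qed.

Lemma snorm_sqr x : P x -> snorm B x ^+ 2 = B x x.
Proof. by move=> Px; rewrite sqr_sqrtr// (si_ge0 PB). Qed.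

Lemma snorm_ge0 x : 0 <= snorm B x.
Proof. exact: sqrtr_ge0. Qed.

Lemma cauchy_schwarz x y : P x -> P y -> `|B x y| <= snorm B x * snorm B y.
Proof.
move=> Px Py; rewrite /snorm -sqrtrM ?(si_ge0 PB)//.
rewrite -sqrtr_sqr ler_wsqrtr//.
have pos a := si_ge0 PB (PD (PZ a Px) Py).
have [B0|B0] := eqVneq (B x x) 0.
  have [->|n0] := eqVneq (B x y) 0; first by rewrite expr0n /= B0 mul0r.
  exfalso; have := pos (- (B y y + 1) / (2 * B x y)).
  rewrite siZD_sqr// B0 mulr0 add0r.
  (* a is chosen so that 2 a B(x, y) + B(y, y) = -1 *)
  rewrite (_ : 2 * _ * _ = - (B y y + 1)); last by field.
  lra.
have Bp : 0 < B x x by rewrite lt_neqAle eq_sym B0 (si_ge0 PB).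
(* the minimizer of the quadratic polynomial of siZD_sqr *)
have := pos (- B x y / B x x); rewrite siZD_sqr//.
rewrite (_ : _ + _ + _ = (B x x * B y y - B x y ^+ 2) / B x x); last by field.
by rewrite pmulr_lge0 ?invr_gt0// subr_ge0.
Qed.

Lemma snormD x y : P x -> P y -> snorm B (x + y) <= snorm B x + snorm B y.
Proof.
move=> Px Py; rewrite -(@ler_pXn2r _ 2) ?nnegrE ?addr_ge0 ?snorm_ge0//.
rewrite snorm_sqr; last exact: PD.
rewrite -[X in B (X + _)]scale1r -[X in B _ (X + _)]scale1r siZD_sqr//.
have := cauchy_schwarz Px Py; have := ler_norm (B x y).
rewrite sqrrD !snorm_sqr// -mulr_natl; lra.
Qed.

Lemma snormN x : P x -> snorm B (- x) = snorm B x.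
Proof.
move=> Px; have PNx := PN Px.
by rewrite /snorm siNl// (siC PB Px PNx) siNl// opprK.
Qed.

Lemma snormB x y : P x -> P y -> snorm B (x - y) = snorm B (y - x).
Proof. by move=> Px Py; rewrite -opprB snormN//; exact: siPB. Qed.

Lemma snorm_le x a : 0 <= a -> P x -> B x x <= a ^+ 2 -> snorm B x <= a.
Proof.
by move=> a0 Px h; rewrite -(@ler_pXn2r _ 2) ?nnegrE ?snorm_ge0// snorm_sqr.
Qed.

(** The representing element minimizes J(x) = B(x, x) - 2 l(x). By the
    parallelogram identity
      B(y - z, y - z) = 2 J(y) + 2 J(z) - 4 J((y + z) / 2),
    minimizing sequences are Cauchy. Testing near-minimality of x_n in the
    direction y bounds B(x_n, y) - l(y) by a multiple of the square root of the
    gap to the infimum, so that no continuity of J is involved in the passage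
    to the limit. *)
Lemma riesz_representation (l : V -> R) (M : R) : complete_for P B ->
  (forall a x y, P x -> P y -> l (a *: x + y) = a * l x + l y) ->
  (forall x, P x -> `|l x| <= M * snorm B x) ->
  exists2 x, P x & forall y, P y -> B x y = l y.
Proof.
move=> cP lZD lM.
have P0 := si0 PB.
have l0 : l 0 = 0.
  by have := lZD 1 0 0 P0 P0; rewrite scaler0 add0r mul1r; lra.
have lZ a x : P x -> l (a *: x) = a * l x.
  by move=> Px; rewrite -[X in l X]addr0 lZD// l0 addr0.
pose J x := B x x - 2 * l x.
have JM x : P x -> - M ^+ 2 <= J x.
  move=> Px; rewrite /J -snorm_sqr//.
  have := lM x Px; have := ler_norm (l x).
  by have := sqr_ge0 (M - snorm B x); nra.
have [m [mJ mE]] : exists m, (forall x, P x -> m <= J x) /\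
    forall e, 0 < e -> exists2 x, P x & J x < m + e.
  have hS : has_inf [set J x | x in P].
    split; first by exists (J 0), 0.
    by exists (- M ^+ 2) => _ [x Px <-]; exact: JM.
  exists (inf [set J x | x in P]); split => [x Px|e e0].
    by apply: ge_inf; [case: hS|exists x].
  by have [_ [x Px <-] xe] := inf_adherent e0 hS; exists x.
have e_gt0 n : 0 < 4^-1 ^+ n / 4 :> R by rewrite divr_gt0// exprn_gt0.
have /choice[x_ /all_and2[Px_ Jx_]] : forall n, exists x,
    P x /\ J x < m + 4^-1 ^+ n / 4.
  by move=> n; have [x] := mE _ (e_gt0 n); exists x.
have [n|x Px xx] := cP x_ Px_.
  set y := x_ n.+1; set z := x_ n.
  have Py : P y by exact: Px_.
  have Pz : P z by exact: Px_.
  have Pyz := PD Py Pz.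
  have -> : B (y - z) (y - z) = 2 * J y + 2 * J z - 4 * J (2^-1 *: (y + z)).
    have := siZD_sqr (-1) Pz Py; rewrite scaleN1r (addrC (- z)) => ->.
    have := siZD_sqr 1 Pz Py; rewrite scale1r (addrC z) => yz.
    rewrite /J siZl ?siZr ?lZ//; last exact: PZ.
    rewrite yz (_ : l (y + z) = l y + l z); last first.
      by rewrite -[X in l (X + _)]scale1r lZD// mul1r.
    by field.
  have := mJ _ (PZ 2^-1 Pyz); have := Jx_ n.+1; have := Jx_ n.
  rewrite -/y -/z exprS; have := e_gt0 n; lra.
exists x => // y Py; apply/eqP; rewrite -subr_eq0 -sqrf_eq0 eq_le sqr_ge0 andbT.
set b := B y y; have b0 : 0 <= b by exact: (si_ge0 PB).
set e := B x y - l y.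
pose dl n := 2 * (b + 1) * (4^-1 ^+ n / 4) + 2 * b * B (x_ n - x) (x_ n - x).
have dl0 : dl n @[n --> \oo] --> (0 : R).
  rewrite -[X in _ --> X]addr0 -[X in _ --> X + _](mulr0 (2 * (b + 1))).
  rewrite -[X in _ --> _ + X](mulr0 (2 * b)).
  apply: cvgD; apply: cvgMl_tmp => //.
  rewrite -[X in _ --> X](mul0r (4^-1)); apply: cvgMr_tmp; apply: cvg_expr.
  by rewrite ger0_norm ?invr_ge0// invf_lt1// ltr1n.
have edl n : e ^+ 2 <= dl n.
  have Px' : P (x_ n - x) by exact: siPB.
  set r := B (x_ n - x) y.
  have r2 : r ^+ 2 <= b * B (x_ n - x) (x_ n - x).
    have := cauchy_schwarz Px' Py.
    rewrite -(@ler_pXn2r _ 2) ?nnegrE//; last first.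
      by rewrite mulr_ge0 ?snorm_ge0.
    by rewrite real_normK ?num_real// exprMn !snorm_sqr// mulrC.
  have er2 : (e + r) ^+ 2 <= (b + 1) * (4^-1 ^+ n / 4).
    (* b + 1 instead of b keeps the optimal step defined when b = 0 *)
    have := mJ _ (siZD PB (- (e + r) / (b + 1)) Py (Px_ n)).
    rewrite /J siZD_sqr// lZD// -/b.
    have -> : B y (x_ n) = r + e + l y.
      by rewrite (siC PB Py)// /r /e siBl//; ring.
    have := Jx_ n; rewrite /J; set eps := 4^-1 ^+ n / 4.
    move=> h1 h2; have b1 : 0 < b + 1 by lra.
    have {h1 h2} h : - eps <= (- (e + r) / (b + 1)) ^+ 2 * b +
      2 * (- (e + r) / (b + 1)) * (r + e) by lra.
    rewrite -ler_pdivrMl// -lerN2; apply: (le_trans h).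
    rewrite -subr_ge0.
    rewrite (_ : _ - _ = ((e + r) / (b + 1)) ^+ 2); last by field; lra.
    exact: sqr_ge0.
  have := sqr_ge0 (e + 2 * r); rewrite /dl; nra.
by apply: (ler_cvg_to (cvg_cst (e ^+ 2)) dl0); exact: nearW.
Qed.

(** Since T moves the iterate of rank m by at most q ^ m times a constant, some
    iterate x_n is moved by at most (1 - q) / 2 ^ (n + 1). Two points moved by
    a and b are at distance at most (a + b) / (1 - q), so that the x_n have the
    geometric increments that completeness asks for. *)
Lemma picard_fixed_point (T : V -> V) (q : R) : complete_for P B ->
  0 <= q < 1 -> (forall x, P x -> P (T x)) ->
  (forall x y, P x -> P y -> snorm B (T x - T y) <= q * snorm B (x - y)) ->
  exists2 x, P x & snorm B (T x - x) = 0.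
Proof.
move=> cP /andP[q0 q1] PT Tq.
have Pit k : P (iter k T 0) by elim: k => [|k ih]; [exact: (si0 PB)|exact: PT].
have itq k : snorm B (T (iter k T 0) - iter k T 0) <= q ^+ k * snorm B (T 0).
  elim: k => [|k ih]; first by rewrite /= subr0 expr0 mul1r.
  rewrite [iter _.+1 _ _]/= (le_trans (Tq _ _ _ _))//; first exact: PT.
  by rewrite exprS -mulrA ler_wpM2l.
have e_gt0 n : 0 < (1 - q) * 2^-1 ^+ n / 2 :> R.
  by rewrite divr_gt0// mulr_gt0 ?exprn_gt0// subr_gt0.
have /choice[x_ /all_and2[Px_ Tx_]] : forall n, exists x,
    P x /\ snorm B (T x - x) <= (1 - q) * 2^-1 ^+ n / 2.
  move=> n.
  have qk0 : q ^+ k * snorm B (T 0) @[k --> \oo] --> (0 : R).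
    rewrite -[X in _ --> X](mul0r (snorm B (T 0))); apply: cvgMr_tmp.
    by apply: cvg_expr; rewrite ger0_norm.
  have [k _ /(_ k (leqnn k))/= kn] := cvgr_le _ qk0 _ (e_gt0 n).
  by exists (iter k T 0); split => //; exact: le_trans kn.
have key n m : snorm B (x_ n - x_ m) <= (2^-1 ^+ n + 2^-1 ^+ m) / 2.
  have Pn := Px_ n; have Pm := Px_ m; have PTn := PT _ Pn; have PTm := PT _ Pm.
  have E : x_ n - x_ m = (x_ n - T (x_ n)) + ((T (x_ n) - T (x_ m)) +
      (T (x_ m) - x_ m)).
    by rewrite addrA subrKA subrKA.
  have := snormD (siPB Pn PTn) (PD (siPB PTn PTm) (siPB PTm Pm)).
  rewrite -E (snormB Pn PTn).
  have := snormD (siPB PTn PTm) (siPB PTm Pm).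
  have := Tq _ _ Pn Pm; have := Tx_ n; have := Tx_ m.
  move=> h1 h2 h3 h4 h5; rewrite -(ler_pM2l (_ : 0 < 1 - q)) ?subr_gt0//; lra.
have Bsn x : P x -> B x x = snorm B x ^+ 2 by move=> Px; rewrite snorm_sqr.
have h4 n : 4^-1 ^+ n = (2^-1 ^+ n) ^+ 2 :> R.
  by rewrite -exprM mulnC exprM; congr (_ ^+ n); field.
have [n|x Px xx] := cP x_ Px_.
  rewrite Bsn; last exact: siPB.
  rewrite h4 ler_pXn2r ?nnegrE ?snorm_ge0 ?exprn_ge0//.
  apply: le_trans (key _ _) _; rewrite exprS.
  by have : 0 < 2^-1 ^+ n :> R; [rewrite exprn_gt0|lra].
exists x => //.
apply/eqP; rewrite -sqrf_eq0 eq_le sqr_ge0 andbT.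
pose dl n := 8 * B (x_ n - x) (x_ n - x) + 2 * 4^-1 ^+ n.
have dl0 : dl n @[n --> \oo] --> (0 : R).
  rewrite -[X in _ --> X]addr0 -[X in _ --> X + _](mulr0 8).
  rewrite -[X in _ --> _ + X](mulr0 2); apply: cvgD; apply: cvgMl_tmp => //.
  apply: cvg_expr.
  by rewrite ger0_norm ?invr_ge0// invf_lt1// ltr1n.
have edl n : snorm B (T x - x) ^+ 2 <= dl n.
  have Pn := Px_ n; have PTn := PT _ Pn; have PTx := PT _ Px.
  rewrite /dl Bsn; last exact: siPB.
  rewrite h4.
  have := snormD (siPB PTx PTn) (PD (siPB PTn Pn) (siPB Pn Px)).
  rewrite [T x - T _ + _]addrA subrKA subrKA.
  have := snormD (siPB PTn Pn) (siPB Pn Px); have := Tq _ _ Px Pn.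
  have := snorm_ge0 (T x - x).
  have := snorm_ge0 (x_ n - x); rewrite (snormB Px Pn).
  have := Tx_ n; have : 0 < 2^-1 ^+ n :> R by rewrite exprn_gt0.
  set a := snorm B (x_ n - x); set p := 2^-1 ^+ n; set g := snorm B (T x - x).
  move=> p0 h1 a0 g0 h2 h3 h5.
  have : g <= 2 * a + p by nra.
  have := sqr_ge0 (2 * a - p); nra.
by apply: (ler_cvg_to (cvg_cst (snorm B (T x - x) ^+ 2)) dl0); exact: nearW.
Qed.

(** Freezing the first argument of F leaves a linear problem, which the Riesz
    representation solves; its solution operator inherits the Lipschitz constant
    q of F, and its fixed point is the solution. *)
Lemma contractive_variational_equation (F : V -> V -> R) (M : V -> R) (q : R) :
  complete_for P B -> 0 <= q < 1 ->
  (forall x, P x -> forall a y z, P y -> P z ->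
     F x (a *: y + z) = a * F x y + F x z) ->
  (forall x y, P x -> P y -> `|F x y| <= M x * snorm B y) ->
  (forall x y z, P x -> P y -> P z ->
     `|F x z - F y z| <= q * snorm B (x - y) * snorm B z) ->
  exists2 x, P x & forall y, P y -> B x y = F x y.
Proof.
move=> cP q1 FZD FM Fq.
have /choice[T TE] : forall x, exists z, P x ->
    P z /\ forall y, P y -> B z y = F x y.
  move=> x; have [Px|nPx] := pselect (P x); last by exists 0.
  have [z Pz zE] := riesz_representation cP (FZD x Px) (fun y => FM x y Px).
  by exists z.
have PT x : P x -> P (T x) by move=> /TE[].
have [x y Px Py|x Px Tx0] := picard_fixed_point cP q1 PT.
  have [PTx TxE] := TE _ Px; have [PTy TyE] := TE _ Py.
  have Pxy := siPB PTx PTy; have := Fq _ _ _ Px Py Pxy.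
  rewrite -TxE// -TyE// -siBl// -snorm_sqr// ger0_norm ?sqr_ge0// expr2.
  have [-> _|s0] := eqVneq (snorm B (T x - T y)) 0.
    by rewrite mulr_ge0 ?snorm_ge0//; case/andP: q1.
  by rewrite ler_pM2r// lt_neqAle eq_sym s0 snorm_ge0.
have [PTx TxE] := TE _ Px.
exists x => // y Py; rewrite -TxE//; apply/eqP; rewrite eq_sym -subr_eq0.
rewrite -siBl// -normr_le0; apply: le_trans (cauchy_schwarz _ Py) _.
  exact: siPB.
by rewrite Tx0 mul0r.
Qed.

End semi_inner_products.

(** * Square integrable functions *)

Section square_integrable.
Context d (T : measurableType d) (R : realType).
Variables (mu : {measure set T -> \bar R}) (D : set T).
Hypothesis mD : measurable D.

Definition sqint (f : T -> R) : \bar R := (\int[mu]_(x in D) ((f x) ^+ 2)%:E)%E.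

Definition sq_integrable (f : T -> R) :=
  measurable_fun D f /\ (sqint f < +oo)%E.

Definition dotL2 (f g : T -> R) : R := \int[mu]_(x in D) (f x * g x).

Lemma sqint_ge0 f : (0 <= sqint f)%E.
Proof. by apply: integral_ge0 => x _; rewrite lee_fin sqr_ge0. Qed.

Lemma measurable_lincomb (f g : T -> R) (a b : R) : measurable_fun D f ->
  measurable_fun D g -> measurable_fun D (fun x => a * f x + b * g x).
Proof. by move=> mf mg; apply: measurable_funD; apply: measurable_funM. Qed.

Let mEsq (f : T -> R) : measurable_fun D f ->
  measurable_fun D (fun x => ((f x) ^+ 2)%:E).
Proof. by move=> mf; apply/measurable_EFinP; exact: measurable_funX. Qed.

Lemma sqint_ge0_le (f g : T -> R) (a : R) : 0 <= a -> measurable_fun D f ->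
  measurable_fun D g ->
  {ae mu, forall x, D x -> `|f x| <= a * `|g x|} ->
  (sqint f <= (a ^+ 2)%:E * sqint g)%E.
Proof.
move=> a0 mf mg fg.
rewrite /sqint -ge0_integralZl_EFin ?sqr_ge0//; last 2 first.
  by move=> x _; rewrite lee_fin sqr_ge0.
  exact: mEsq.
apply: ae_ge0_le_integral => //.
- by move=> x _; rewrite lee_fin sqr_ge0.
- exact: mEsq.
- by move=> x _; rewrite lee_fin mulr_ge0 ?sqr_ge0.
- apply/measurable_EFinP; apply: measurable_funM => //.
  exact: measurable_funX.
apply: filterS fg => x fg Dx; rewrite lee_fin -(real_normK (num_real (f x))).
rewrite -(real_normK (num_real (g x))) -exprMn ler_pXn2r ?nnegrE ?mulr_ge0//.
exact: fg.
Qed.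

(** A quasi-triangle inequality for the square of the norm: it holds for
    extended real values, and is all that convergence to 0 requires. *)
Lemma sqint_lincomb_le (f g : T -> R) (a b : R) : measurable_fun D f ->
  measurable_fun D g -> (sqint (fun x => (a * f x + b * g x)%R)
    <= (2 * a ^+ 2)%:E * sqint f + (2 * b ^+ 2)%:E * sqint g)%E.
Proof.
move=> mf mg.
have a2 : 0 <= 2 * a ^+ 2 by rewrite mulr_ge0 ?sqr_ge0.
have b2 : 0 <= 2 * b ^+ 2 by rewrite mulr_ge0 ?sqr_ge0.
have sq0 (h : T -> R) x : D x -> (0 <= ((h x) ^+ 2)%:E)%E.
  by move=> _; rewrite lee_fin sqr_ge0.
have sqZ0 (h : T -> R) c x : 0 <= c -> D x -> (0 <= c%:E * ((h x) ^+ 2)%:E)%E.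
  by move=> c0 _; rewrite lee_fin mulr_ge0// sqr_ge0.
have mZ (h : T -> R) c : measurable_fun D h ->
    measurable_fun D (fun x => (c%:E * ((h x) ^+ 2)%:E)%E).
  move=> mh; apply/measurable_EFinP; apply: measurable_funM => //.
  exact: measurable_funX.
rewrite /sqint -!ge0_integralZl_EFin//;
  try by [move=> x; exact: sq0|exact: mEsq].
rewrite -ge0_integralD//; try by [move=> x; exact: sqZ0|exact: mZ].
apply: ge0_le_integral => //.
- by move=> x _; rewrite lee_fin sqr_ge0.
- by apply: mEsq; exact: measurable_lincomb.
- by apply: emeasurable_funD; exact: mZ.
move=> x _; rewrite -!EFinM -EFinD lee_fin.
by have := sqr_ge0 (a * f x - b * g x); nra.
Qed.

Lemma sq_integrable_lincomb (f g : T -> R) (a b : R) : sq_integrable f ->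
  sq_integrable g -> sq_integrable (fun x => a * f x + b * g x).
Proof.
move=> [mf f2] [mg g2]; split; first exact: measurable_lincomb.
apply: le_lt_trans (sqint_lincomb_le _ _ mf mg) _.
by apply: lte_add_pinfty; apply: lte_mul_pinfty => //;
  rewrite lee_fin mulr_ge0 ?sqr_ge0.
Qed.

Lemma sq_integrable_le (f g : T -> R) (a : R) : 0 <= a -> measurable_fun D f ->
  sq_integrable g -> {ae mu, forall x, D x -> `|f x| <= a * `|g x|} ->
  sq_integrable f.
Proof.
move=> a0 mf [mg g2] fg; split => //.
apply: le_lt_trans (sqint_ge0_le a0 mf mg fg) _.
by rewrite lte_mul_pinfty// lee_fin sqr_ge0.
Qed.

Lemma integrable_mul (f g : T -> R) : sq_integrable f -> sq_integrable g ->
  mu.-integrable D (EFin \o (fun x => f x * g x)).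
Proof.
move=> [mf f2] [mg g2].
have isq (h : T -> R) : measurable_fun D h -> (sqint h < +oo)%E ->
    mu.-integrable D (fun x => ((h x) ^+ 2)%:E).
  move=> mh h2; apply/integrableP; split; first exact: mEsq.
  rewrite (eq_integral (fun x => ((h x) ^+ 2)%:E))// => x _.
  by rewrite gee0_abs// lee_fin sqr_ge0.
apply: (le_integrable mD _ _ (integrableD mD (isq _ mf f2) (isq _ mg g2))).
  by apply/measurable_EFinP; exact: measurable_funM.
move=> x _ /=; rewrite lee_fin [leRHS]ger0_norm ?addr_ge0 ?sqr_ge0// normrM.
rewrite -(real_normK (num_real (f x))) -(real_normK (num_real (g x))).
by have := sqr_ge0 (`|f x| - `|g x|); have := sqr_ge0 (`|f x| + `|g x|); nra.
Qed.

Lemma sqintE (f : T -> R) : sq_integrable f -> sqint f = (dotL2 f f)%:E.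
Proof.
move=> [mf f2]; rewrite /dotL2 /Rintegral fineK//.
by rewrite ge0_fin_numE// integral_ge0// => x _; rewrite lee_fin -expr2 sqr_ge0.
Qed.

(** R^o is the copy of R that makes functions into an R-module. *)
Lemma semi_inner_L2 : semi_inner (sq_integrable : set (T -> R^o))
  (dotL2 : (T -> R^o) -> (T -> R^o) -> R).
Proof.
have P0 : sq_integrable (cst 0).
  split => //; rewrite /sqint (eq_integral (cst 0%E)) ?integral0//.
  by move=> x _; rewrite /= expr0n.
split => //.
- move=> a x y Px Py.
  rewrite (_ : a *: x + y = fun z => a * x z + 1 * y z).
    exact: sq_integrable_lincomb.
  by apply/funext => z; rewrite mul1r.
- by move=> x y _ _; apply: eq_Rintegral => z _; rewrite mulrC.
- move=> a x y z Px Py Pz.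
  rewrite /dotL2 -RintegralZl//; last exact: integrable_mul.
  rewrite -RintegralD//; last 2 first.
  + by have := integrableZl mD a (integrable_mul Px Pz).
  + exact: integrable_mul.
  by apply: eq_Rintegral => t _ /=; rewrite mulrDl -mulrA.
- by move=> x _; apply: Rintegral_ge0 => t _; rewrite -expr2 sqr_ge0.
Qed.

Lemma sqint_eq0 (f : T -> R) : measurable_fun D f -> sqint f = 0%E ->
  {ae mu, forall x, D x -> f x = 0}.
Proof.
move=> mf f0.
have /(ae_eq_integral_abs mu mD (mEsq mf)) :
    (\int[mu]_(x in D) `|((f x) ^+ 2)%:E| = 0)%E.
  rewrite -f0; apply: eq_integral => x _.
  by rewrite gee0_abs// lee_fin sqr_ge0.
apply: filterS => x fx Dx; have /eqP := fx Dx.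
by rewrite eqe sqrf_eq0 => /eqP.
Qed.

(** Cauchy-Schwarz for the sum of the increments a_(k+1) - a_k, with weights
    2 ^ -k and 2 ^ k; the first factor is the sum of the 2 ^ -k. *)
Lemma sqr_telescope_le (a : nat -> R) n m : (n <= m)%N ->
  (a m - a n) ^+ 2 <= (2 * 2^-1 ^+ n - 2 * 2^-1 ^+ m) *
     \sum_(n <= k < m) 2 ^+ k * (a k.+1 - a k) ^+ 2.
Proof.
elim: m => [|m ih].
  by rewrite leqn0 => /eqP ->; rewrite big_geq// !subrr mulr0 expr0n.
rewrite leq_eqVlt => /predU1P[->|].
  by rewrite big_geq// !subrr mul0r expr0n.
rewrite ltnS => nm; rewrite big_nat_recr//=; have {ih} := ih nm.
set S := \sum_(_ <= _ < _) _; set p : R := 2^-1 ^+ m; set q : R := 2^-1 ^+ n.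
have S0 : 0 <= S.
  by apply: sumr_ge0 => i _; rewrite mulr_ge0 ?sqr_ge0 ?exprn_ge0.
have p0 : 0 < p by rewrite exprn_gt0.
have qp : p <= q.
  rewrite /p /q -(subnK nm) exprD ger_pMl ?exprn_gt0//.
  by rewrite exprn_ile1// invf_le1// ler1n.
have -> : 2 ^+ m = p^-1 :> R by rewrite /p exprVn invrK.
rewrite (exprS _ m) -/p.
rewrite (_ : a m.+1 - a n = (a m - a n) + (a m.+1 - a m)); last by ring.
set s := a m - a n; set e := a m.+1 - a m.
set A := 2 * q - 2 * p => sA; have A0 : 0 <= A by rewrite /A; lra.
have -> : 2 * q - 2 * (2^-1 * p) = A + p by rewrite /A; field.
rewrite mulrDl !mulrDr (_ : p * (p^-1 * e ^+ 2) = e ^+ 2); last by field; lra.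
rewrite sqrrD.
suff : 2 * (s * e) <= A * (p^-1 * e ^+ 2) + p * S by rewrite -mulr_natl; lra.
set u := A * _; set v := p * S.
have u0 : 0 <= u by rewrite mulr_ge0// mulr_ge0 ?sqr_ge0// invr_ge0 ltW.
have v0 : 0 <= v by rewrite mulr_ge0// ltW.
have uv : (s * e) ^+ 2 <= u * v.
  rewrite exprMn (_ : u * v = A * S * e ^+ 2).
    by rewrite ler_wpM2r// sqr_ge0.
  by rewrite /u /v; field; lra.
rewrite (le_trans (ler_norm _))// -(@ler_pXn2r _ 2) ?nnegrE ?addr_ge0//.
rewrite real_normK ?num_real// exprMn; have := sqr_ge0 (u - v); nra.
Qed.

(** Completeness of L^2. The function S = sum of the 2 ^ k (f_(k+1) - f_k)^2 has
    a finite integral by monotone convergence, and sqr_telescope_le bounds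
    (f_m - f_n)^2 by 2 ^ (1 - n) S pointwise. Hence f_n converges wherever S is
    finite, and the same bound passes to the limit in m and then under the
    integral. *)
Lemma riesz_fischer (f : nat -> T -> R) (C : R) : 0 <= C ->
  (forall n, sq_integrable (f n)) ->
  (forall n, sqint (f n.+1 \- f n)%R <= (C * 4^-1 ^+ n)%:E)%E ->
  exists2 g, sq_integrable g & sqint (f n \- g)%R @[n --> \oo] --> 0%E.
Proof.
move=> C0 Pf fC.
pose t k x : \bar R := (2 ^+ k * (f k.+1 x - f k x) ^+ 2)%:E.
have t0 k x : (0 <= t k x)%E by rewrite lee_fin mulr_ge0 ?sqr_ge0 ?exprn_ge0.
have mt k : measurable_fun D (t k).
  apply/measurable_EFinP; apply: measurable_funM => //; apply: measurable_funX.
  by apply: measurable_funB; [exact: (Pf k.+1).1|exact: (Pf k).1].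
pose S x : \bar R := (\sum_(k <oo) t k x)%E.
have S0 x : (0 <= S x)%E by exact: nneseries_ge0.
have mS : measurable_fun D S by apply: ge0_emeasurable_sum => //.
have intS : (\int[mu]_(x in D) S x <= (2 * C)%:E)%E.
  rewrite integral_nneseries//.
  apply: lime_le; first by apply: is_cvg_nneseries => *; exact: integral_ge0.
  apply: nearW => N.
  apply: (@le_trans _ _ (\sum_(0 <= k < N) (C * 2^-1 ^+ k)%:E)%E).
    apply: lee_sum => k _; rewrite /t.
    under eq_integral do rewrite EFinM.
    rewrite ge0_integralZl_EFin//; last 2 first.
    - by move=> x _; rewrite lee_fin sqr_ge0.
    - apply: mEsq.
      by apply: measurable_funB; [exact: (Pf k.+1).1|exact: (Pf k).1].
    apply: (@le_trans _ _ ((2 ^+ k)%:E * (C * 4^-1 ^+ k)%:E)%E).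
      by rewrite lee_pmul2l ?lte_fin ?exprn_gt0//; exact: fC.
    rewrite -EFinM lee_fin mulrCA -exprMn ler_wpM2l//.
    by rewrite (_ : 2 * 4^-1 = 2^-1 :> R)//; field.
  rewrite sumEFin lee_fin -mulr_sumr mulrC ler_wpM2r//.
  suff -> : \sum_(0 <= k < N) 2^-1 ^+ k = 2 - 2 * 2^-1 ^+ N :> R.
    by rewrite gerBl mulr_ge0// exprn_ge0.
  elim: N => [|N ih]; first by rewrite big_geq// expr0 mulr1 subrr.
  by rewrite big_nat_recr//= ih exprS; field.
pose E := D `&` [set x | S x \is a fin_num].
have mE : measurable E by exact: emeasurable_fin_num.
have ED : E `<=` D by move=> x [].
have nE : mu (D `\` E) = 0%E.
  apply/(measure_negligible (measurableD mD mE)).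
  have [|A [mA A0 AS]] := @integrable_ae _ _ _ mu D mD S.
    apply/integrableP; split => //; rewrite (eq_integral S); last first.
      by move=> x _; rewrite gee0_abs.
    by apply: le_lt_trans intS _; rewrite ltry.
  exists A; split => // x [Dx nEx]; apply: AS => /= /(_ Dx) Sx.
  by apply: nEx; split.
have key n m x : E x -> (n <= m)%N ->
    (f m x - f n x) ^+ 2 <= 2 * 2^-1 ^+ n * fine (S x).
  move=> [Dx Sx] nm; apply: le_trans (sqr_telescope_le (f ^~ x) nm) _.
  have p0 k : 0 < 2^-1 ^+ k :> R by rewrite exprn_gt0.
  have b : \sum_(n <= k < m) 2 ^+ k * (f k.+1 x - f k x) ^+ 2 <= fine (S x).
    rewrite -lee_fin fineK// -sumEFin.
    apply: le_trans (nneseries_lim_ge m _); last by move=> *; exact: t0.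
    rewrite [leRHS](@big_cat_nat _ _ _ n)//= leeDr// sume_ge0// => *; exact: t0.
  apply: (@le_trans _ _ (2 * 2^-1 ^+ n *
      (\sum_(n <= k < m) 2 ^+ k * (f k.+1 x - f k x) ^+ 2))).
    rewrite ler_wpM2r//; last by rewrite gerBl mulr_ge0// ltW.
    by apply: sumr_ge0 => k _; rewrite mulr_ge0 ?sqr_ge0 ?exprn_ge0.
  by rewrite ler_wpM2l// mulr_ge0// ltW.
have h0 : (2^-1 ^+ n : R) @[n --> \oo] --> (0 : R).
  by apply: cvg_expr; rewrite ger0_norm ?invr_ge0// invf_lt1// ltr1n.
have cf x : E x -> cvgn (f ^~ x).
  move=> Ex; apply/cauchy_cvgP; apply/cauchy_exP => e e0.
  have c0 : 2 * 2^-1 ^+ n * fine (S x) @[n --> \oo] --> (0 : R).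
    rewrite -[X in _ --> X](mul0r (fine (S x))); apply: cvgMr_tmp.
    by rewrite -[X in _ --> X](mulr0 2); apply: cvgMl_tmp.
  have [n _ /(_ n (leqnn n))/= nE'] := cvgr_lt _ c0 _ (exprn_gt0 2 e0).
  exists (f n x); exists n => // m /= nm.
  rewrite /ball/= distrC -(@ltr_pXn2r _ 2) ?nnegrE// ?ltW//.
  rewrite real_normK ?num_real//.
  by apply: le_lt_trans nE'; exact: key.
(* cutting off outside E gives a sequence that converges everywhere *)
pose h n x := f n x * \1_E x.
pose g x := limn (h ^~ x).
have ch x : cvgn (h ^~ x).
  have [Ex|nEx] := pselect (E x).
    rewrite (_ : h ^~ x = f ^~ x); first exact: cf.
    by apply/funext => n; rewrite /h indicE mem_set// mulr1.
  rewrite (_ : h ^~ x = cst 0); first exact: is_cvg_cst.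
  by apply/funext => n; rewrite /h indicE memNset// mulr0.
have mh n : measurable_fun D (h n).
  apply: measurable_funM; [exact: (Pf n).1|].
  exact: measurable_indic.
have mg : measurable_fun D g.
  apply: (measurable_fun_cvg mh) => x _; exact: ch.
have gE x : E x -> f n x @[n --> \oo] --> g x.
  move=> Ex; rewrite (_ : f ^~ x = h ^~ x); first exact: ch.
  by apply/funext => n; rewrite /h indicE mem_set// mulr1.
have fg n : (sqint (f n \- g)%R <= (2 * 2^-1 ^+ n)%:E * (2 * C)%:E)%E.
  have mfg : measurable_fun D (f n \- g).
    by apply: measurable_funB => //; exact: (Pf n).1.
  rewrite /sqint.
  rewrite (ge0_negligible_integral (measurableD mD mE) _ _ _ nE)//;
    last 2 first.
  - exact: mEsq.
  - by move=> x _; rewrite lee_fin sqr_ge0.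
  rewrite setDD (setIidr ED).
  apply: (@le_trans _ _ (\int[mu]_(x in E) ((2 * 2^-1 ^+ n)%:E * S x))%E).
    apply: ge0_le_integral => //.
    - by move=> x _; rewrite lee_fin sqr_ge0.
    - exact: (measurable_funS mD ED (mEsq mfg)).
    - by apply: emeasurable_funM => //; exact: (measurable_funS mD ED mS).
    move=> x Ex; have [_ Sx] := Ex; rewrite -[S x]fineK// -EFinM lee_fin.
    have cfg : (f m x - f n x) ^+ 2 @[m --> \oo] --> (g x - f n x) ^+ 2.
      have cB : f m x - f n x @[m --> \oo] --> g x - f n x.
        by apply: cvgB; [exact: gE|exact: cvg_cst].
      rewrite !expr2; under eq_fun do rewrite expr2.
      exact: cvgM.
    rewrite /= -(opprB (g x)) sqrrN; apply: (ler_cvg_to cfg (cvg_cst _)).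
    by exists n => // m /= nm; exact: key.
  rewrite ge0_integralZl_EFin//; last exact: (measurable_funS mD ED mS).
  rewrite lee_pmul2l ?lte_fin ?mulr_gt0 ?exprn_gt0//.
  by apply: le_trans intS; apply: ge0_subset_integral.
exists g.
  rewrite (_ : g = fun x => 1 * f 0 x + (-1) * (f 0 \- g) x).
    apply: sq_integrable_lincomb => //; split.
      by apply: measurable_funB => //; exact: (Pf 0).1.
    by apply: le_lt_trans (fg 0) _; rewrite -EFinM ltry.
  by apply/funext => x /=; rewrite mul1r mulN1r opprB addrC subrK.
apply: (@squeeze_cvge _ _ _ _ (cst 0%E) _
    (fun n => (2 * 2^-1 ^+ n)%:E * (2 * C)%:E)%E).
- by apply: nearW => n; rewrite sqint_ge0 fg.
- exact: cvg_cst.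
under eq_fun do rewrite -EFinM.
apply: cvg_EFin; first exact: nearW.
rewrite (_ : 0 = (2 * 0) * (2 * C))%R; last by rewrite mulr0 mul0r.
by apply: cvgMr_tmp; apply: cvgMl_tmp.
Qed.

End square_integrable.

Section L2_limits.
Context d (T : measurableType d) (R : realType).
Variables (mu : {measure set T -> \bar R}) (D : set T).
Hypothesis mD : measurable D.

Lemma dotL2_cvg (f : nat -> T -> R) (g h : T -> R) :
  (forall n, sq_integrable mu D (f n)) -> sq_integrable mu D g ->
  sq_integrable mu D h -> sqint mu D (f n \- g)%R @[n --> \oo] --> 0%E ->
  dotL2 mu D (f n) h @[n --> \oo] --> dotL2 mu D g h.
Proof.
move=> Pf Pg Ph fg; have si := semi_inner_L2 mu mD.
pose ip : (T -> R^o) -> (T -> R^o) -> R := dotL2 mu D.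
have Pfg n : sq_integrable mu D (f n \- g).
  exact: (siPB si (Pf n) Pg).
have /fine_cvgP[_ fg0] := fg.
have s0 : snorm ip (f n \- g) * snorm ip h @[n --> \oo] --> (0 : R).
  rewrite -[X in _ --> X](mul0r (snorm ip h)).
  apply: cvgM; last exact: cvg_cst.
  rewrite -[X in _ --> X](@sqrtr0 R).
  apply: (@continuous_cvg _ _ _ _ _ _ (@Num.sqrt R)).
    exact: sqrt_continuous.
  apply: cvg_trans fg0; apply: near_eq_cvg; apply: nearW => n /=.
  by rewrite sqintE.
apply/cvgrPdist_le => e e0.
have [N _ NS] := cvgr_le _ s0 _ e0; exists N => // n /= /NS; apply: le_trans.
rewrite distrC -(siBl si (Pf n) Pg Ph).
exact: (cauchy_schwarz si (Pfg n) Ph).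
Qed.

End L2_limits.

(** * Test functions *)

Section test_functions.
Variables (R : realType) (n : nat).
Implicit Types (D K : set 'rV[R]_n) (f g psi : 'rV[R]_n -> R).

Lemma continuous_measurable_rV f :
  continuous (f : 'rV[R]_n -> R^o) -> measurable_fun setT f.
Proof.
move=> cf; apply: (measurability _ (RGenOpens.measurableE R)).
move=> _ [_ [a [b ->] <-]]; rewrite setTI; apply: open_measurable_rV.
by apply: open_comp; [move=> x _; exact: cf|exact: interval_open].
Qed.

Lemma closed_measurable_rV D : closed D -> measurable D.
Proof.
move=> cD; rewrite -(setCK D); apply: measurableC.
by apply: open_measurable_rV; exact: closed_openC.
Qed.

(** A compact set lies in a cube, whose measure is a finite product. *)
Lemma lebesgue_rV_compact_lty K :
  compact K -> (lebesgue_rV R n K < +oo)%E.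
Proof.
move=> cK; have [M [_ KM]] := compact_bounded cK.
have {}KM x : K x -> `|x| <= M + 1 by apply: KM; rewrite ltrDl.
have mK : measurable K.
  apply: closed_measurable_rV; apply: compact_closed cK.
  exact: norm_hausdorff.
pose A (_ : 'I_n) : set R := [set` `[- (M + 1), M + 1]].
have mA i : measurable (A i) by exact: measurable_itv.
apply: (@le_lt_trans _ _ (lebesgue_rV R n [set x | forall i, A i (x ord0 i)])).
  apply: le_measure; rewrite ?inE//.
    rewrite [X in measurable X](_ : _ = \bigcap_(i in [set: 'I_n])
      ((fun x : 'rV[R]_n => x ord0 i) @^-1` A i)).
      apply: fin_bigcap_measurable => // i _; rewrite -[X in measurable X]setTI.
      exact: measurable_coord.
    by apply/seteqP; split => x /= h i; [move=> _|]; exact: h.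
  move=> x /KM xM i; rewrite /A /= in_itv /= -ler_norml; apply: le_trans xM.
  rewrite [leRHS]/Num.norm /= mx_normrE; apply/bigmax_geP; right => /=.
  by exists (ord0, i).
suff h : lebesgue_rV R n [set x | forall i, A i (x ord0 i)] \is a fin_num.
  by rewrite ltey_eq h.
rewrite lebesgue_rV_rect//; apply: (big_ind (fun x => x \is a fin_num)) => //.
- exact: fin_numM.
- by move=> i _; rewrite /A lebesgue_measure_itv; case: ifP.
Qed.


Lemma smooth_foldr_lincomb f g a b (s : seq 'rV[R]_n) : smooth f -> smooth g ->
  foldr (fun v h => 'D_v h) ((fun x => a * f x + b * g x) : 'rV[R]_n -> R^o) s =
  (fun x => a * foldr (fun v h => 'D_v h) (f : 'rV[R]_n -> R^o) s x +
            b * foldr (fun v h => 'D_v h) (g : 'rV[R]_n -> R^o) s x).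
Proof.
move=> sf sg; elim: s => //= v s ->; apply/funext => x.
have [_ df] := sf s; have [_ dg] := sg s.
set F := foldr _ _ _ in df *; set G := foldr _ _ _ in dg *.
rewrite (_ : (fun x => _) = (a \*: F) + (b \*: G))//.
by rewrite deriveD ?deriveZ//; exact: derivableZ.
Qed.

Lemma smooth_lincomb f g a b :
  smooth f -> smooth g -> smooth (fun x => a * f x + b * g x).
Proof.
move=> sf sg s /=; rewrite smooth_foldr_lincomb//.
have [cf df] := sf s; have [cg dg] := sg s.
set F := foldr _ _ _ in cf df *; set G := foldr _ _ _ in cg dg *.
rewrite (_ : (fun x => _) = (a \*: F) + (b \*: G))//.
split=> [x|x v]; last by apply: derivableD; exact: derivableZ.
by apply: continuousD; apply: continuousZ;
  do ?[exact: cst_continuous|exact: cf|exact: cg].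
Qed.

Lemma test_fun_lincomb D f g a b :
  test_fun D f -> test_fun D g -> test_fun D (fun x => a * f x + b * g x).
Proof.
move=> [sf cf fD] [sg cg gD].
have sub : closure [set x | a * f x + b * g x != 0] `<=`
    closure [set x | f x != 0] `|` closure [set x | g x != 0].
  rewrite -closureU; apply: closureS => x /= h.
  have [f0|] := eqVneq (f x) 0; last by left.
  by right; apply: contra_neq h => ->; rewrite f0 !mulr0 addr0.
split; first exact: smooth_lincomb.
  apply: subclosed_compact (sub); [exact: closed_closure|exact: compactU].
by move=> x /sub[/fD|/gD].
Qed.

Lemma sq_integrable_compact_support D K (h : 'rV[R]_n -> R) :
  measurable D -> continuous (h : 'rV[R]_n -> R^o) -> compact K ->
  (forall x, ~ K x -> h x = 0) -> sq_integrable (lebesgue_rV R n) D h.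
Proof.
move=> mD ch cK hK.
have mK : measurable K.
  apply: closed_measurable_rV; apply: compact_closed cK.
  exact: norm_hausdorff.
have [M [_ hM]] : bounded_set ((h : 'rV[R]_n -> R^o) @` K).
  apply: compact_bounded; apply: continuous_compact => //.
  exact: continuous_subspaceT.
have {}hM x : K x -> `|h x| <= `|M| + 1.
  move=> Kx; apply: (hM (`|M| + 1)); last by exists x.
  by rewrite (le_lt_trans (ler_norm M))// ltrDl.
apply: (@sq_integrable_le _ _ _ _ _ mD _ (\1_K) (`|M| + 1)).
- by rewrite addr_ge0.
- apply: measurable_funTS; exact: continuous_measurable_rV.
- split; first exact: measurable_indic.
  rewrite /sqint (eq_integral (fun x => (\1_K x)%:E)); last first.
    by move=> x _; rewrite indicE; case: (x \in K); rewrite ?expr1n ?expr0n.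
  rewrite integral_indic//; apply: le_lt_trans (lebesgue_rV_compact_lty cK).
  by rewrite le_measure ?inE//; exact: measurableI.
apply: aeW => x _; have [Kx|nKx] := pselect (K x).
  by rewrite indicE mem_set// normr1 mulr1 hM.
by rewrite hK// normr0 mulr_ge0// addr_ge0.
Qed.

Lemma test_fun_measurable D E psi : test_fun E psi -> measurable_fun D psi.
Proof.
move=> [/(_ [::])[cpsi _] _ _]; apply: measurable_funTS.
exact: continuous_measurable_rV.
Qed.

Lemma test_fun_sq_integrable D E psi : measurable D -> test_fun E psi ->
  sq_integrable (lebesgue_rV R n) D psi.
Proof.
move=> mD [/(_ [::])[cp _] cK _].
apply: (sq_integrable_compact_support mD cp cK) => x nx.
by apply/eqP; apply: contra_notT nx => h; exact: subset_closure.
Qed.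

Lemma test_fun_partial_sq_integrable D E psi i : measurable D ->
  test_fun E psi -> sq_integrable (lebesgue_rV R n) D (partial i psi).
Proof.
move=> mD [/(_ [:: delta_mx ord0 i])[cp _] cK _].
apply: (sq_integrable_compact_support mD cp cK) => x nx.
rewrite /partial -(derive_cst (0 : R^o) x (delta_mx ord0 i)).
apply: near_eq_derive.
have : nbhs x (~` closure [set x | psi x != 0]).
  by apply: open_nbhs_nbhs; split => //; apply/closed_openC/closed_closure.
apply: filterS => y ny; apply/eqP; apply: contra_notT ny => h.
exact: subset_closure.
Qed.

End test_functions.

(** * The graph space H(u, Q) *)

Section graph_space.
Variables (R : realType) (d : nat) (Q : set 'rV[R]_d.+1).
Variables (u : 'rV[R]_d.+1 -> 'rV[R]_d) (nt : 'rV[R]_d.+1 -> R).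
Hypothesis mQ : measurable Q.
Hypothesis uoo : forall i, Linfty (lebesgue_rV R d.+1) Q (fun z => u z ord0 i).
Hypothesis mI : measurable (inflow Q nt).
Hypothesis mnt : measurable_fun (inflow Q nt) nt.
Implicit Types (c w g psi : 'rV[R]_d.+1 -> R).

Local Notation leb := (lebesgue_rV R d.+1).

(** The derivative of psi along the field (1, u). *)
Definition transport psi (z : 'rV[R]_d.+1) : R :=
  \sum_i tilde u z ord0 i * partial i psi z.

(** In this form the relation between c and its divergence w is made of inner
    products with fixed square integrable functions, hence is linear and closed
    in L^2. *)
Lemma is_tdivE c w : is_tdiv Q u c w <-> forall psi, test_fun Q psi ->
  dotL2 leb Q c (transport psi) = - dotL2 leb Q w psi.
Proof.
suff h psi :
    \int[leb]_(x in Q) (\sum_i (c x *: tilde u x) ord0 i * partial i psi x) =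
    dotL2 leb Q c (transport psi).
  by split => H psi /H; rewrite /= h.
apply: eq_Rintegral => z _; rewrite /transport mulr_sumr.
by apply: eq_bigr => i _; rewrite mxE mulrA.
Qed.

Lemma transport_sq_integrable E psi :
  test_fun E psi -> sq_integrable leb Q (transport psi).
Proof.
move=> tpsi; rewrite /transport.
have tilde_oo i : Linfty leb Q (fun z => tilde u z ord0 i).
  case: (unliftP ord0 i) => [j ->|->].
    rewrite (_ : (fun z => _) = (fun z => u z ord0 j)); first exact: uoo.
    by apply/funext => z; rewrite /tilde /rV_cons mxE liftK.
  rewrite (_ : (fun z => _) = cst 1).
    by split => //; exists 1; apply: aeW => z _; rewrite normr1.
  by apply/funext => z; rewrite /tilde /rV_cons mxE unlift_none.
have sqi i : sq_integrable leb Q (fun z => tilde u z ord0 i * partial i psi z).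
  have [mt [M tM]] := tilde_oo i.
  have dpsi := test_fun_partial_sq_integrable i mQ tpsi.
  apply: (@sq_integrable_le _ _ _ _ _ mQ _ (partial i psi) `|M|) => //.
    by apply: measurable_funM => //; exact: dpsi.1.
  apply: filterS tM => z tM Qz; rewrite normrM ler_wpM2r//.
  exact: le_trans (tM Qz) (ler_norm _).
rewrite (_ : (fun z => _) = \sum_(i < d.+1)
    ((fun z => tilde u z ord0 i * partial i psi z) : 'rV[R]_d.+1 -> R^o)).
  apply: (big_ind (fun f => sq_integrable leb Q f)) => //.
    exact: (si0 (semi_inner_L2 leb mQ)).
  move=> f g Pf Pg; rewrite -[f]scale1r.
  exact: (siZD (semi_inner_L2 leb mQ)).
by apply/funext => z; rewrite fct_sumE.
Qed.

Lemma is_tdiv_lincomb (a b : R) c c' w w' :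
  L2 Q c -> L2 Q c' -> L2 Q w -> L2 Q w' ->
  is_tdiv Q u c w -> is_tdiv Q u c' w' ->
  is_tdiv Q u (fun z => a * c z + b * c' z) (fun z => a * w z + b * w' z).
Proof.
move=> Lc Lc' Lw Lw' /is_tdivE cw /is_tdivE cw'; apply/is_tdivE => psi tpsi.
have lin f g h : sq_integrable leb Q f -> sq_integrable leb Q g ->
    sq_integrable leb Q h ->
    dotL2 leb Q (fun z => a * f z + b * g z) h =
    a * dotL2 leb Q f h + b * dotL2 leb Q g h.
  move=> Pf Pg Ph; have si := semi_inner_L2 leb mQ.
  rewrite -(siZl si b Pg Ph) -(siZDl si a Pf _ Ph)//.
  rewrite -[_ *: _]addr0; apply: (siZD si) => //; exact: (si0 si).
have tT := transport_sq_integrable tpsi.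
have tL := test_fun_sq_integrable mQ tpsi.
by rewrite !lin// cw// cw'// !mulrN opprD.
Qed.

(** The weight |nt|^(1/2) turns the inflow seminorm into an L^2 norm. *)
Lemma inflow_sqnormE g : inflow_sqnorm Q nt g =
  sqint (surface R d) (inflow Q nt) (fun z => g z * ((- nt z) `^ 2^-1)).
Proof.
apply: eq_integral => z; rewrite inE => -[_ z0].
have nz : 0 <= - nt z by rewrite oppr_ge0 ltW.
by rewrite exprMn powR12_sqrt// sqr_sqrtr// mulrN.
Qed.

Let mweight g : measurable_fun (inflow Q nt) g ->
  measurable_fun (inflow Q nt) (fun z => g z * ((- nt z) `^ 2^-1)).
Proof.
move=> mg; apply: measurable_funM => //.
apply: (measurableT_comp (measurable_powR 2^-1)).
exact: measurable_funN.
Qed.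

Lemma inflow_sqnorm_ge0 g : (0 <= inflow_sqnorm Q nt g)%E.
Proof. by rewrite inflow_sqnormE sqint_ge0. Qed.

Lemma inflow_sqnorm0 : inflow_sqnorm Q nt (cst 0) = 0%E.
Proof. by apply: integral0_eq => z _; rewrite expr0n /= mul0r oppr0. Qed.

Lemma inflow_sqnorm_lincomb_le (a b : R) g h :
  measurable_fun (inflow Q nt) g -> measurable_fun (inflow Q nt) h ->
  (inflow_sqnorm Q nt (fun z => (a * g z + b * h z)%R) <=
   (2 * a ^+ 2)%:E * inflow_sqnorm Q nt g +
   (2 * b ^+ 2)%:E * inflow_sqnorm Q nt h)%E.
Proof.
move=> mg mh; rewrite !inflow_sqnormE.
rewrite (_ : (fun z => _ * _) = fun z => a * (g z * (- nt z) `^ 2^-1) +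
    b * (h z * (- nt z) `^ 2^-1)); last first.
  by apply/funext => z; rewrite mulrDl !mulrA.
by apply: sqint_lincomb_le => //; exact: mweight.
Qed.

Lemma inflow_L2_lincomb (a b : R) g h : inflow_L2 Q nt g -> inflow_L2 Q nt h ->
  inflow_L2 Q nt (fun z => a * g z + b * h z).
Proof.
move=> [mg g2] [mh h2]; split; first exact: measurable_lincomb.
apply: le_lt_trans (inflow_sqnorm_lincomb_le _ _ mg mh) _.
by apply: lte_add_pinfty; apply: lte_mul_pinfty => //;
  rewrite lee_fin mulr_ge0 ?sqr_ge0.
Qed.

Let sqnorm_ge0 c : (0 <= sqnorm Q c)%E.
Proof. exact: sqint_ge0. Qed.

Lemma Hsqnorm_ge0 c w g : (0 <= Hsqnorm Q nt c w g)%E.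
Proof.
apply: adde_ge0; last exact: inflow_sqnorm_ge0.
by apply: adde_ge0; exact: sqnorm_ge0.
Qed.

Lemma Hsqnorm_lincomb_le (a b : R) c c' w w' g g' :
  measurable_fun Q c -> measurable_fun Q c' ->
  measurable_fun Q w -> measurable_fun Q w' ->
  measurable_fun (inflow Q nt) g -> measurable_fun (inflow Q nt) g' ->
  (Hsqnorm Q nt (fun z => (a * c z + b * c' z)%R)
     (fun z => (a * w z + b * w' z)%R) (fun z => (a * g z + b * g' z)%R) <=
   (2 * a ^+ 2)%:E * Hsqnorm Q nt c w g +
   (2 * b ^+ 2)%:E * Hsqnorm Q nt c' w' g')%E.
Proof.
move=> mc mc' mw mw' mg mg'; rewrite /Hsqnorm.
have muleD3 (r : R) (x y z : \bar R) : (0 <= x)%E -> (0 <= y)%E -> (0 <= z)%E ->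
    (r%:E * (x + y + z) = r%:E * x + r%:E * y + r%:E * z)%E.
  by move=> x0 y0 z0; rewrite !ge0_muleDr// adde_ge0.
rewrite !muleD3; try by [exact: sqnorm_ge0|exact: inflow_sqnorm_ge0].
rewrite [leRHS]addeACA [X in (_ <= X + _)%E]addeACA.
apply: leeD; last exact: inflow_sqnorm_lincomb_le.
by apply: leeD; exact: sqint_lincomb_le.
Qed.

Lemma in_H_lincomb (a b : R) c c' w w' g g' :
  in_H Q u nt c w g -> in_H Q u nt c' w' g' ->
  in_H Q u nt (fun z => a * c z + b * c' z) (fun z => a * w z + b * w' z)
    (fun z => a * g z + b * g' z).
Proof.
move=> [Lc Lw Lg cw [phi [v [tphi pv cvg]]]].
move=> [Lc' Lw' Lg' cw' [phi' [v' [tphi' pv' cvg']]]].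
split.
- exact: sq_integrable_lincomb.
- exact: sq_integrable_lincomb.
- exact: inflow_L2_lincomb.
- exact: is_tdiv_lincomb.
exists (fun m z => a * phi m z + b * phi' m z),
  (fun m z => a * v m z + b * v' m z).
split.
- by move=> m; exact: test_fun_lincomb.
- move=> m; have [Lv dv] := pv m; have [Lv' dv'] := pv' m.
  split; first exact: sq_integrable_lincomb.
  by apply: is_tdiv_lincomb => //; exact: test_fun_sq_integrable.
pose h1 m := Hsqnorm Q nt (phi m \- c) (v m \- w) (phi m \- g).
pose h2 m := Hsqnorm Q nt (phi' m \- c') (v' m \- w') (phi' m \- g').
apply: (@squeeze_cvge _ _ _ _ (cst 0%E) _
    (fun m => (2 * a ^+ 2)%:E * h1 m + (2 * b ^+ 2)%:E * h2 m)%E).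
- apply: nearW => m; rewrite Hsqnorm_ge0 /=.
  have := @Hsqnorm_lincomb_le a b (phi m \- c) (phi' m \- c') (v m \- w)
    (v' m \- w') (phi m \- g) (phi' m \- g').
  have E (f f' k k' : 'rV[R]_d.+1 -> R) :
      (fun z => a * (f \- k) z + b * (f' \- k') z) =
      (fun z => a * f z + b * f' z) \- (fun z => a * k z + b * k' z).
    by apply/funext => z /=; ring.
  rewrite !E; apply; apply: measurable_funB; try exact: test_fun_measurable.
  + exact: Lc.1.
  + exact: Lc'.1.
  + exact: (pv m).1.1.
  + exact: Lw.1.
  + exact: (pv' m).1.1.
  + exact: Lw'.1.
  + exact: Lg.1.
  + exact: Lg'.1.
- exact: cvg_cst.
rewrite -[X in _ --> X](adde0 0%E).
rewrite -[X in _ --> (X + _)%E](mule0 (2 * a ^+ 2)%:E).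
rewrite -[X in _ --> (_ + X)%E](mule0 (2 * b ^+ 2)%:E).
by apply: cvgeD; [rewrite !mule0| |]; [|apply: cvgeZl|apply: cvgeZl].
Qed.

(** A diagonal argument: the n-th approximating test function is taken at a
    squared distance at most 1 / (n + 1) from (c_n, w_n, g). *)
Lemma in_H_closed (c_ w_ : nat -> 'rV[R]_d.+1 -> R) c w g :
  (forall n, in_H Q u nt (c_ n) (w_ n) g) -> L2 Q c -> L2 Q w ->
  sqnorm Q (c_ n \- c) @[n --> \oo] --> 0%E ->
  sqnorm Q (w_ n \- w) @[n --> \oo] --> 0%E ->
  in_H Q u nt c w g.
Proof.
move=> Hn Lc Lw cc ww.
have Lg : inflow_L2 Q nt g by case: (Hn 0).
have Lcn n : L2 Q (c_ n) by case: (Hn n).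
have Lwn n : L2 Q (w_ n) by case: (Hn n).
split => //.
  apply/is_tdivE => psi tpsi.
  have tT := transport_sq_integrable tpsi.
  have tL := test_fun_sq_integrable mQ tpsi.
  have h1 := dotL2_cvg mQ Lcn Lc tT cc.
  have h2 : - dotL2 leb Q (w_ n) psi @[n --> \oo] --> - dotL2 leb Q w psi.
    by apply: cvgN; exact: dotL2_cvg ww.
  have E : (fun n => dotL2 leb Q (c_ n) (transport psi)) =
      (fun n => - dotL2 leb Q (w_ n) psi).
    by apply/funext => n; case: (Hn n) => _ _ _ /is_tdivE/(_ _ tpsi).
  rewrite E in h1.
  by rewrite -(cvg_lim (@Rhausdorff R) h1) (cvg_lim (@Rhausdorff R) h2).
have /choice[p pP] : forall n,
    exists p : ('rV[R]_d.+1 -> R) * ('rV[R]_d.+1 -> R),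
    [/\ test_fun setT p.1, L2 Q p.2, is_tdiv Q u p.1 p.2 &
     (Hsqnorm Q nt (p.1 \- c_ n)%R (p.2 \- w_ n)%R (p.1 \- g)%R <=
       (n.+1%:R^-1)%:E)%E].
  move=> n; have [_ _ _ _ [phi [v [tphi pv /fine_cvgP[finc cvg]]]]] := Hn n.
  have n0 : 0 < n.+1%:R^-1 :> R by rewrite invr_gt0.
  have [m [fm hm]] := filter_ex (filterI finc (cvgr_le _ cvg _ n0)).
  exists (phi m, v m); split => //=; [exact: (pv m).1|exact: (pv m).2|].
  by rewrite -(fineK fm) lee_fin.
exists (fun n => (p n).1), (fun n => (p n).2); split.
- by move=> n; case: (pP n).
- by move=> n; case: (pP n).
apply: (@squeeze_cvge _ _ _ _ (cst 0%E) _
    (fun n => (2 * 1 ^+ 2)%:E * (n.+1%:R^-1)%:E +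
      (2 * 1 ^+ 2)%:E * (sqnorm Q (c_ n \- c)%R + sqnorm Q (w_ n \- w)%R))%E).
- apply: nearW => n; rewrite Hsqnorm_ge0 /=.
  have [tp Lp dp hp] := pP n.
  have := @Hsqnorm_lincomb_le 1 1 ((p n).1 \- c_ n) (c_ n \- c)
    ((p n).2 \- w_ n) (w_ n \- w) ((p n).1 \- g) (cst 0).
  have E (f k l : 'rV[R]_d.+1 -> R) :
      (fun z => 1 * (f \- k) z + 1 * (k \- l) z) = f \- l.
    by apply/funext => z /=; ring.
  have E0 : (fun z => 1 * ((p n).1 \- g) z + 1 * cst 0 z) = (p n).1 \- g.
    by apply/funext => z /=; ring.
  rewrite !E E0.
  move=> h; apply: (le_trans (h _ _ _ _ _ _)) => {h}.
  + by apply: measurable_funB; [exact: test_fun_measurable tp|exact: (Lcn n).1].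
  + by apply: measurable_funB; [exact: (Lcn n).1|exact: Lc.1].
  + by apply: measurable_funB; [exact: Lp.1|exact: (Lwn n).1].
  + by apply: measurable_funB; [exact: (Lwn n).1|exact: Lw.1].
  + by apply: measurable_funB; [exact: test_fun_measurable tp|exact: Lg.1].
  + exact: measurable_cst.
  rewrite [X in (_ + _ * X)%E]/Hsqnorm inflow_sqnorm0 adde0.
  by apply: leeD => //; rewrite lee_pmul2l// lte_fin expr1n mulr1.
- exact: cvg_cst.
rewrite -[X in _ --> X](adde0 0%E).
rewrite -[X in _ --> (X + _)%E](mule0 (2 * 1 ^+ 2)%:E).
rewrite -[X in _ --> (_ + X)%E](mule0 (2 * 1 ^+ 2)%:E).
rewrite -[X in _ --> (_ + _ * X)%E](adde0 0%E).
apply: cvgeD; first by rewrite !mule0.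
  by apply: cvgeZl => //; exact: cvge_harmonic.
apply: cvgeZl => //.
by apply: cvgeD.
Qed.

End graph_space.

(** * The boundary value problem *)

Section superposition.
Context d (T : measurableType d) (R : realType).
Variables (mu : {measure set T -> \bar R}) (D : set T).
Hypothesis mD : measurable D.
Variables (f : R -> R) (k : R).
Hypothesis fk : forall x y, `|f x - f y| <= k * `|x - y|.

Lemma lipschitz_measurable : measurable_fun setT f.
Proof.
apply: continuous_measurable_fun => x; apply/cvgrPdist_lt => e e0.
have k0 : 0 < `|k| + 1 by rewrite ltr_wpDl.
have ek : 0 < e / (`|k| + 1) by rewrite divr_gt0.
apply: filterS (nbhsx_ballx x _ ek) => y; rewrite /ball /= => xy.
apply: le_lt_trans (fk x y) _.
apply: (@le_lt_trans _ _ ((`|k| + 1) * `|x - y|)).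
  by rewrite ler_wpM2r// (le_trans (ler_norm _))// lerDl.
by rewrite -ltr_pdivlMl// mulrC.
Qed.

Lemma measurable_superposition (c : T -> R) :
  measurable_fun D c -> measurable_fun D (f \o c).
Proof.
by move=> mc; apply: measurableT_comp => //; exact: lipschitz_measurable.
Qed.

(** |f(c)| <= k |c| + |f(0)|, where the constant |f(0)| must be square
    integrable on D. *)
Lemma sq_integrable_superposition (c : T -> R) :
  (mu D < +oo)%E \/ f 0 = 0 -> sq_integrable mu D c ->
  sq_integrable mu D (f \o c).
Proof.
move=> hD Pc.
have -> : f \o c = fun z => 1 * (f (c z) - f 0) + 1 * cst (f 0) z.
  by apply/funext => z /=; ring.
have k0 : 0 <= k.
  by have := fk 0 1; rewrite sub0r normrN normr1 mulr1; exact: le_trans.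
apply: sq_integrable_lincomb => //.
  apply: (@sq_integrable_le _ _ _ _ _ mD _ c k) => //.
    apply: measurable_funB => //.
    by apply: measurable_superposition; exact: Pc.1.
  by apply: aeW => z _; rewrite -[X in _ <= _ * `|X|]subr0.
split => //; rewrite /sqint /= (integral_cst _ mD (f 0 ^+ 2)%:E).
case: hD => [Doo|->].
  by apply: lte_mul_pinfty => //; rewrite lee_fin sqr_ge0.
by rewrite expr0n mul0e.
Qed.

End superposition.

Section cylinders.
Variables (R : realType) (d : nat) (Om : set 'rV[R]_d) (T : R).

Lemma cylinderE :
  cylinder Om T = @rV_uncons R d @^-1` (`]0, T[%classic `*` Om).
Proof.
apply/seteqP; split => z /=; rewrite in_itv /=; first by case.
by case.
Qed.

Lemma measurable_cylinder : measurable Om -> measurable (cylinder Om T).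
Proof.
move=> mOm; rewrite cylinderE -[X in measurable X]setTI.
by apply: measurable_rV_uncons => //; exact: measurableX.
Qed.

Lemma lebesgue_cylinder_lty : measurable Om ->
  (lebesgue_rV R d Om < +oo -> lebesgue_rV R d.+1 (cylinder Om T) < +oo)%E.
Proof.
move=> mOm Omoo.
rewrite /= /lebesgue_next /pushforward cylinderE -comp_preimage.
rewrite (_ : _ \o _ = id); last exact/funext/rV_consK.
rewrite preimage_id product_measure1E// lte_mul_pinfty//.
suff : lebesgue_measure (`]0, T[%classic : set R) \is a fin_num by [].
by rewrite lebesgue_measure_itv; case: ifP.
Qed.

End cylinders.

Section inflow_boundary.
Variables (R : realType) (d : nat) (Q : set 'rV[R]_d.+1).
Variable nt : 'rV[R]_d.+1 -> R.
Hypothesis mnt : measurable_fun (boundary Q) nt.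

Let measurable_boundary : measurable (boundary Q).
Proof.
apply: measurableD; first by apply: closed_measurable_rV; exact: closed_closure.
by apply: open_measurable_rV; exact: open_interior.
Qed.

Lemma measurable_inflow : measurable (inflow Q nt).
Proof.
rewrite (_ : inflow Q nt = boundary Q `&` nt @^-1` `]-oo, 0[%classic).
  by apply: mnt => //; exact: measurable_itv.
by apply/seteqP; split => z /=; rewrite in_itv /=.
Qed.

Lemma measurable_fun_inflow : measurable_fun (inflow Q nt) nt.
Proof. by apply: measurable_funS mnt => // z []. Qed.

End inflow_boundary.

Section variational_problem.
Variables (R : realType) (d : nat) (Q : set 'rV[R]_d.+1).
Variables (u : 'rV[R]_d.+1 -> 'rV[R]_d) (nt : 'rV[R]_d.+1 -> R) (cp : R).
Hypothesis mQ : measurable Q.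
Hypothesis uoo : forall i, Linfty (lebesgue_rV R d.+1) Q (fun z => u z ord0 i).
Hypothesis mI : measurable (inflow Q nt).
Hypothesis mnt : measurable_fun (inflow Q nt) nt.
Hypothesis cp0 : 0 <= cp.
Hypothesis poincare : curved_poincare Q u nt cp.

Local Notation leb := (lebesgue_rV R d.+1).
Local Notation fspace := ('rV[R]_d.+1 -> R^o).
Local Notation dot := (dotL2 leb Q : fspace -> fspace -> R).

Let si := semi_inner_L2 leb mQ.

(** On functions of zero trace the curved Poincare inequality bounds c by its
    divergence w, so that the L^2 norm of w alone controls both. *)
Lemma poincare_H0 c w : in_H0 Q u nt c w ->
  (sqnorm Q c <= (cp ^+ 2)%:E * sqnorm Q w)%E.
Proof. by move=> /poincare; rewrite inflow_sqnorm0 adde0. Qed.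

Lemma poincare_snorm c w : in_H0 Q u nt c w -> snorm dot c <= cp * snorm dot w.
Proof.
move=> cw; have := poincare_H0 cw; have [Lc Lw _ _ _] := cw.
rewrite -[sqnorm Q c]/(sqint leb Q c) -[sqnorm Q w]/(sqint leb Q w).
rewrite !sqintE// -EFinM lee_fin => h.
rewrite -(@ler_pXn2r _ 2) ?nnegrE ?mulr_ge0 ?snorm_ge0//.
by rewrite exprMn !(snorm_sqr si).
Qed.

Lemma in_HB c c' w w' g : in_H Q u nt c w g -> in_H Q u nt c' w' g ->
  in_H0 Q u nt (c \- c') (w \- w').
Proof.
move=> h h'; have := in_H_lincomb mQ uoo mI mnt 1 (-1) h h'; rewrite /in_H0.
have E (p q : 'rV[R]_d.+1 -> R) : (fun z => 1 * p z + -1 * q z) = p \- q.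
  by apply/funext => z /=; ring.
by rewrite !E (_ : g \- g = cst 0)//; apply/funext => z /=; rewrite subrr.
Qed.

Lemma in_HD c c0 w w0 g : in_H Q u nt c0 w0 g -> in_H0 Q u nt c w ->
  in_H Q u nt (c0 \+ c) (w0 \+ w) g.
Proof.
move=> h h0; have := in_H_lincomb mQ uoo mI mnt 1 1 h h0.
have E (p q : 'rV[R]_d.+1 -> R) : (fun z => 1 * p z + 1 * q z) = p \+ q.
  by apply/funext => z /=; ring.
by rewrite !E (_ : g \+ cst 0 = g)//; apply/funext => z /=; rewrite addr0.
Qed.

(** A function is paired with its divergence, which is_tdiv treats as a
    relation. *)
Definition H0_graph : set (fspace * fspace) := [set p | in_H0 Q u nt p.1 p.2].

Definition dotH0 (p q : fspace * fspace) : R := dot p.2 q.2.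

(** That H_0 contains 0 follows from the existence of one function of H(u, Q),
    by subtraction. *)
Lemma semi_inner_H0 c0 w0 g : in_H Q u nt c0 w0 g -> semi_inner H0_graph dotH0.
Proof.
move=> h0.
have L p : H0_graph p -> sq_integrable leb Q p.2 by case.
split.
- rewrite /H0_graph /=; have := in_HB h0 h0.
  have E (p : 'rV[R]_d.+1 -> R) : p \- p = 0 :> fspace by exact: subrr.
  by rewrite !E.
- move=> a x y Px Py; have := in_H_lincomb mQ uoo mI mnt a 1 Px Py.
  have E (p q : fspace) : (fun z => a * p z + 1 * q z) = a *: p + q.
    by apply/funext => z /=; rewrite mul1r.
  have E0 : a *: (cst 0 : fspace) + cst 0 = cst 0.
    by apply/funext => z; apply: etrans (addr0 _) (mulr0 _).
  by rewrite !E E0.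
- by move=> x y Px Py; apply: (siC si); exact: L.
- by move=> a x y z Px Py Pz; apply: (siZDl si); exact: L.
- by move=> x Px; apply: (si_ge0 si); exact: L.
Qed.

(** The Poincare inequality turns a Cauchy sequence of divergences into a Cauchy
    sequence of functions; L^2 is complete and the graph is closed. *)
Lemma complete_H0 : complete_for H0_graph dotH0.
Proof.
move=> x_ Px_ dx_.
have Lc n : L2 Q (x_ n).1 by case: (Px_ n).
have Lw n : L2 Q (x_ n).2 by case: (Px_ n).
have Hd n : in_H0 Q u nt ((x_ n.+1).1 \- (x_ n).1) ((x_ n.+1).2 \- (x_ n).2).
  exact: in_HB (Px_ n.+1) (Px_ n).
have wd n : (sqint leb Q ((x_ n.+1).2 \- (x_ n).2)%R <= (1 * 4^-1 ^+ n)%:E)%E.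
  have [_ Lwd _ _ _] := Hd n.
  by rewrite sqintE// lee_fin mul1r; exact: dx_.
have cd n :
    (sqint leb Q ((x_ n.+1).1 \- (x_ n).1)%R <= (cp ^+ 2 * 4^-1 ^+ n)%:E)%E.
  apply: le_trans (poincare_H0 (Hd n)) _; rewrite (EFinM (cp ^+ 2)).
  apply: lee_wpmul2l; first by rewrite lee_fin sqr_ge0.
  by have := wd n; rewrite mul1r.
have [c Pc cc] := riesz_fischer mQ (sqr_ge0 cp) Lc cd.
have [w Pw cw] := riesz_fischer mQ ler01 Lw wd.
exists (c, w).
  exact: (in_H_closed mQ uoo mI mnt (c_ := fun n => (x_ n).1)
    (w_ := fun n => (x_ n).2)).
have /fine_cvgP[_ h] := cw.
apply: cvg_trans h; apply: near_eq_cvg; apply: nearW => n /=.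
by rewrite sqintE//; exact: (siPB si (Lw n) Pw).
Qed.

Section nonlinear.
Variables (f : R -> R) (k : R).
Hypothesis fk : forall x y, `|f x - f y| <= k * `|x - y|.
Hypothesis kcp : k * cp < 1.
Hypothesis fQ : (leb Q < +oo)%E \/ f 0 = 0.

Let k0 : 0 <= k.
Proof.
by have := fk 0 1; rewrite sub0r normrN normr1 mulr1; exact: le_trans.
Qed.

Let Lf c : sq_integrable leb Q c -> sq_integrable leb Q (f \o c).
Proof. by move=> Lc; exact: (sq_integrable_superposition mQ fk). Qed.

Lemma superposition_snorm c c' :
  sq_integrable leb Q c -> sq_integrable leb Q c' ->
  snorm dot ((f \o c) \- (f \o c')) <= k * snorm dot (c \- c').
Proof.
move=> Lc Lc'.
have Pf := siPB si (Lf Lc) (Lf Lc'); have Pc := siPB si Lc Lc'.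
apply: (snorm_le si) => //; first by rewrite mulr_ge0 ?snorm_ge0.
rewrite exprMn (snorm_sqr si)// -lee_fin EFinM -!sqintE//.
apply: sqint_ge0_le => //; [exact: Pf.1|exact: Pc.1|].
by apply: aeW => z _ /=.
Qed.

Let contraction_factor : 0 <= k * cp < 1.
Proof. by rewrite mulr_ge0. Qed.

(** Where the smallness of k enters: Cauchy-Schwarz, the Lipschitz bound and
    the Poincare inequality give the factor k cp < 1. *)
Lemma forcing_contraction c c' w v : sq_integrable leb Q c ->
  sq_integrable leb Q c' -> in_H0 Q u nt (c \- c') w -> sq_integrable leb Q v ->
  `|dot (f \o c) v - dot (f \o c') v| <= k * cp * snorm dot w * snorm dot v.
Proof.
move=> Lc Lc' cw Lv.
rewrite -(siBl si (Lf Lc) (Lf Lc') Lv).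
have Pf := siPB si (Lf Lc) (Lf Lc').
apply: le_trans (cauchy_schwarz si Pf Lv) _; rewrite ler_wpM2r ?snorm_ge0//.
apply: le_trans (superposition_snorm Lc Lc') _.
by rewrite -mulrA ler_wpM2l//; exact: poincare_snorm.
Qed.

(** Writing c = c0 + psi with (psi, w) in H_0, the equation says that w and
    f(c0 + psi) - w0 have the same inner product with the divergence of every
    test function of H_0. *)
Lemma solution_exists c0 w0 cb : in_H Q u nt c0 w0 cb ->
  exists c w, is_solution Q u nt f cb c w.
Proof.
move=> H0; have siH := semi_inner_H0 H0.
have [Lc0 Lw0 _ _ _] := H0.
have Lp p : H0_graph p -> sq_integrable leb Q p.1 /\ sq_integrable leb Q p.2.
  by case.
pose C (p : fspace * fspace) : fspace := c0 \+ p.1.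
have LC p : H0_graph p -> sq_integrable leb Q (C p).
  by move=> /Lp[L1 _]; have := siZD si 1 Lc0 L1; rewrite scale1r.
pose G p : fspace := (f \o C p) - w0.
have LG p : H0_graph p -> sq_integrable leb Q (G p).
  by move=> Pp; exact: (siPB si (Lf (LC _ Pp)) Lw0).
pose F (p q : fspace * fspace) := dot (G p) q.2.
have [|||x Px xE] := @contractive_variational_equation _ _ _ _ siH
    F (fun p => snorm dot (G p)) (k * cp) complete_H0 contraction_factor.
- move=> x Px a y z /Lp[_ Ly] /Lp[_ Lz].
  rewrite /F; have := siZDl si a Ly Lz (LG _ Px).
  by rewrite !(siC si _ (LG _ Px))//; exact: (siZD si).
- move=> x y Px /Lp[_ Ly]; exact: (cauchy_schwarz si (LG _ Px) Ly).
- move=> x y z Px Py /Lp[_ Lz].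
  have [LCx LCy] := (LC _ Px, LC _ Py).
  rewrite /F /G (siBl si (Lf LCx) Lw0 Lz) (siBl si (Lf LCy) Lw0 Lz).
  rewrite opprB addrA subrK.
  apply: (forcing_contraction LCx LCy _ Lz).
  rewrite (_ : C x \- C y = x.1 \- y.1); first exact: (in_HB Px Py).
  by apply/funext => t /=; rewrite /C /=; ring.
exists (c0 \+ x.1), (w0 \+ x.2); split; first exact: in_HD.
move=> phi wphi Hphi; have [_ Lw _ _ _] := Hphi.
have := xE (phi, wphi) Hphi.
rewrite /dotH0 /F /G /= (siBl si (Lf (LC _ Px)) Lw0 Lw) => xw.
apply: etrans (siDl si Lw0 (Lp _ Px).2 Lw) _.
by rewrite xw addrC subrK.
Qed.

(** The difference of two solutions has zero trace, hence is an admissible test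
    function; the contraction estimate then forces its divergence to vanish, and
    the Poincare inequality the difference itself. *)
Lemma solution_unique cb c w c' w' :
  is_solution Q u nt f cb c w -> is_solution Q u nt f cb c' w' ->
  {ae leb, forall z, Q z -> c' z = c z /\ w' z = w z}.
Proof.
move=> [H cE] [H' cE'].
have [[Lc Lw _ _ _] [Lc' Lw' _ _ _]] := (H, H').
have Hd := in_HB H' H; have [Lcd Lwd _ _ _] := Hd.
have s0 : snorm dot (w' \- w) = 0.
  have := forcing_contraction Lc' Lc Hd Lwd.
  have -> : dot (f \o c') (w' \- w) - dot (f \o c) (w' \- w) =
      snorm dot (w' \- w) ^+ 2.
    rewrite (snorm_sqr si)//; apply/esym.
    apply: etrans (siBl si Lw' Lw Lwd) _.
    by congr (_ - _); [exact: cE' Hd|exact: cE Hd].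
  rewrite ger0_norm ?sqr_ge0// => h; apply/eqP.
  have [//|n0] := eqVneq (snorm dot (w' \- w)) 0.
  have p0 : 0 < snorm dot (w' \- w) by rewrite lt_neqAle eq_sym n0 snorm_ge0.
  exfalso; move: h; rewrite expr2 ler_pM2r// ler_pMl// leNgt => /negP; exact.
have sw : sqint leb Q (w' \- w) = 0%E.
  by rewrite sqintE// -(snorm_sqr si)// s0 expr0n.
have sc : sqint leb Q (c' \- c) = 0%E.
  apply/eqP; rewrite eq_le sqint_ge0 andbT.
  apply: le_trans (poincare_H0 Hd) _.
  by rewrite -[sqnorm _ _]/(sqint _ _ _) sw mule0.
have := sqint_eq0 mQ Lcd.1 sc; have := sqint_eq0 mQ Lwd.1 sw.
apply: filterS2 => z wz cz Qz.
by split; apply/eqP; rewrite -subr_eq0; apply/eqP; [exact: cz|exact: wz].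
Qed.

End nonlinear.

End variational_problem.

Theorem theorem3p1 (R : realType) (d : nat) (Om : set 'rV[R]_d) (T : R)
    (u : 'rV[R]_d.+1 -> 'rV[R]_d) (divu nt : 'rV[R]_d.+1 -> R)
    (cp k : R) (f : R -> R) (cb : 'rV[R]_d.+1 -> R) :
  let Q := cylinder Om T in
  let leb := lebesgue_rV R d.+1 in
  (0 < d)%N ->
  open Om -> connected Om -> Om !=set0 ->
  lipschitz_boundary Om -> cone_property Om ->
  0 < T ->
  (forall i, Linfty leb Q (fun z => u z ord0 i)) ->
  Linfty leb Q divu -> is_spatial_div Q u divu ->
  is_normal_trace Q u divu nt ->
  inflow_cylindrical Om T nt ->
  0 < cp -> curved_poincare Q u nt cp ->
  in_G Q u nt cb ->
  k.-lipschitz (f : R^o -> R^o) -> k < cp^-1 ->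
  (lebesgue_rV R d Om < +oo)%E \/ f 0 = 0 ->
  exists c w, is_solution Q u nt f cb c w /\
    forall c' w', is_solution Q u nt f cb c' w' ->
      {ae leb, forall z, Q z -> c' z = c z /\ w' z = w z}.
Proof.
move=> Q leb _ oOm _ _ _ _ _ uoo _ _ [[mnt _] _] _ cp0 poincare [c0 [w0 H0]].
move=> fk kcp fOm.
have mOm : measurable Om by exact: open_measurable_rV.
have mQ : measurable Q by exact: measurable_cylinder.
have mI := measurable_inflow mnt; have mntI := measurable_fun_inflow mnt.
have {}fk x y : `|f x - f y| <= k * `|x - y| by exact: (fk (x, y)).
have {}kcp : k * cp < 1 by rewrite -ltr_pdivlMr// div1r.
have fQ : (leb Q < +oo)%E \/ f 0 = 0.
  by case: fOm => [Omoo|]; [left; exact: lebesgue_cylinder_lty|right].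
have [c [w cw]] :=
  solution_exists mQ uoo mI mntI (ltW cp0) poincare fk kcp fQ H0.
exists c, w; split => // c' w'.
exact: (solution_unique mQ uoo mI mntI (ltW cp0) poincare fk kcp fQ cw).
Qed.
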